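(* Let $G$ be a virtually free group with a free subgroup $F$ of finite index $m$. Then $G$ is strongly Howson and $$\xi_G(n_1,n_2) \leq m^2(n_1-1)(n_2-1) + m$$ for all integers $n_1,n_2\geq 1$.
   Context: For a finitely generated group $H$, the rank is $\mathrm{rk}(H) = \min\{|X| : H = \langle X\rangle\}$ (infinite if $H$ is not finitely generated). A group $G$ is strongly Howson if for all $n_1,n_2 \in \mathbb{N}$, $$\sup\{\mathrm{rk}(H_1\cap H_2) \mid H_1,H_2\leq G,\ \mathrm{rk}(H_1)\leq n_1,\ \mathrm{rk}(H_2)\leq n_2\} < \infty.$$ In that case $\xi_G(n_1,n_2)$ denotes this supremum. A group is virtually free if it has a free subgroup of finite index. *)

(* Defs.v *)
From mathcomp Require Import all_boot all_order all_algebra finmap.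
From mathcomp Require Import boolp classical_sets cardinality reals ereal Rstruct.
From Stdlib Require Rdefinitions.

Set Implicit Arguments.
Unset Strict Implicit.
Unset Printing Implicit Defensive.

Import Order.TTheory GRing.Theory Num.Theory.

Local Open Scope classical_set_scope.
Local Open Scope group_scope.

Notation RR := Rdefinitions.R.

Section Groups.
Context {G : groupType}.
Implicit Types (H F X : set G) (n m : nat).

Definition subgroup H : Prop := group_closed [in H].

Definition generated X : set G := smallest subgroup X.

Definition left_coset F (x : G) : set G := [set x * y | y in F].

Definition has_index F m : Prop := (range (left_coset F) #= `I_m)%card.

(* The letter (x, false) stands for x and (x, true) for its formal inverse. *)
Definition letter_val (l : G * bool) : G := if l.2 then l.1^-1 else l.1.

Definition word_val (w : seq (G * bool)) : G := \big[*%g/1]_(l <- w) letter_val l.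

Definition reduced (w : seq (G * bool)) : bool :=
  sorted (fun l l' => ~~ ((l.1 == l'.1) && (l.2 != l'.2))) w.

Definition free_basis X F : Prop :=
  generated X = F /\
  forall w : seq (G * bool),
    (forall l, l \in w -> X l.1) -> reduced w -> w != [::] -> word_val w <> 1.

Definition free_subgroup F : Prop :=
  subgroup F /\ exists X : set G, free_basis X F.

(* The infimum is over a set of natural numbers, so it is a minimum, or +oo when
   H has no finite generating set. *)
Definition rk H : \bar RR :=
  ereal_inf [set (#|` X|%:R%R)%:E | X in
             [set X : {fset G} | generated [set` X] = H]].

End Groups.

Definition xi (G : groupType) (n1 n2 : nat) : \bar RR :=
  ereal_sup [set r | exists H1 H2 : set G,
    [/\ subgroup H1, subgroup H2,
        (rk H1 <= (n1%:R%R)%:E)%E, (rk H2 <= (n2%:R%R)%:E)%E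
      & r = rk (H1 `&` H2)]].

Definition strongly_Howson (G : groupType) : Prop :=
  forall n1 n2 : nat, (xi G n1 n2 < +oo)%E.

(* Main.v *)
Require Import Defs.
From mathcomp Require Import all_boot all_order all_algebra finmap zify ring.
From mathcomp Require Import boolp classical_sets cardinality ereal Rstruct.

(** Let [H1] and [H2] be generated by [n1] and [n2] elements.  Intersecting with
    [F] multiplies the number of generators minus one by at most [m] (Schreier),
    in [F] the Hanna Neumann inequality
    [rk (H `&` K) - 1 <= (rk H - 1) * (rk K - 1)] applies, and a generating set of
    [H1 `&` H2 `&` F] becomes one of [H1 `&` H2] when at most [m - 1] coset
    representatives are added.  This gives the bound [m^2 (n1 - 1) (n2 - 1) + m].

    The Hanna Neumann inequality is proved by the argument of Mineyev and Dicks,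
    carried over from trees to finite graphs.  A subgroup with [n] generators of
    the free group is the loop group of a finite connected graph labelled by
    letters, which can be folded and has at most [n - 1] more edges than vertices
    ([bouquet], [fold_graph]).  By the Magnus expansion the free group has a
    two-sided invariant order; it induces an order on the edges of the Cayley
    tree, hence on the edges of each reduced path, and comparing two edges of a
    path only takes the labels between them.  Call an edge of a labelled graph a
    bridge if it is the maximum of some line, that is of a reduced two-way
    infinite path.  Let [V], [E] and [B] count vertices, edges and bridges.

    - Maps of labelled graphs send lines to lines and bridges to bridges.  So
      the fibre product of two graphs has at most as many bridges as there are
      pairs of bridges ([card_bridges_fibre]); if the graphs are folded, its loop
      group is the intersection of the two loop groups ([loops_fibre]).
    - [B <= E - V] for connected graphs with nontrivial loop group
      ([card_bridges_le]).
    - [E - V <= B] for folded graphs ([card_bridges_ge]).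

    The component of the base point in the fibre product of the graphs of [H] and
    [K] therefore has [E - V] at most [(rk H - 1) * (rk K - 1)], and the loop
    group of a connected graph has rank at most [E - V + 1]
    ([loops_generated]). *)

Set Implicit Arguments.
Unset Strict Implicit.
Unset Printing Implicit Defensive.

Import Order.TTheory GRing.Theory Num.Theory.

(** * Words and free reduction *)

Section Words.
Local Open Scope group_scope.
Context {S : eqType}.
Implicit Types (l : S * bool) (w : seq (S * bool)).

Definition linv l : S * bool := (l.1, ~~ l.2).
Definition winv w : seq (S * bool) := rev [seq linv l | l <- w].
Definition redw w : bool := sorted (fun l l' => l' != linv l) w.

Lemma linvK : involutive linv.
Proof. by case=> s b; rewrite /linv /= negbK. Qed.

Lemma linv_neq l : linv l != l.
Proof. by case: l => s b; rewrite /linv xpair_eqE /=; case: b; rewrite andbF. Qed.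

Lemma redw_cons l w : redw (l :: w) = (if w is l' :: _ then l' != linv l else true) && redw w.
Proof. by case: w. Qed.

Lemma redw_behead l w : redw (l :: w) -> redw w.
Proof. by rewrite redw_cons => /andP[]. Qed.

Lemma redw_winv w : redw w -> redw (winv w).
Proof.
rewrite /redw /winv rev_sorted sorted_map; apply: sub_sorted => l l' /=.
by rewrite linvK eq_sym.
Qed.

Lemma redw_cat w w' l l' :
  redw (rcons w l) -> redw (l' :: w') -> l' != linv l ->
  redw (rcons w l ++ l' :: w').
Proof.
rewrite /redw => hw hw' hl; case: w hw => [|k w] /= hw; first by rewrite hl.
by rewrite cat_path hw last_rcons /= hl.
Qed.

Definition nf w : seq (S * bool) :=
  foldr (fun l w => if w is l' :: w' then if l' == linv l then w' else l :: w
                    else [:: l]) [::] w.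

Lemma redw_nf w : redw (nf w).
Proof.
elim: w => //= l w; case: (nf w) => // l' w' hw.
by case: eqP hw => [_ /redw_behead //|/eqP ne hw]; rewrite redw_cons ne.
Qed.

Section Values.
Context {G : groupType} (x : S -> G).

Definition lval l : G := letter_val (x l.1, l.2).
Definition wval w : G := word_val [seq (x l.1, l.2) | l <- w].

Lemma wval_nil : wval [::] = 1. Proof. by rewrite /wval /word_val big_nil. Qed.
Lemma wval_cons l w : wval (l :: w) = lval l * wval w.
Proof. by rewrite /wval /word_val /= big_cons. Qed.
Lemma wval1 l : wval [:: l] = lval l.
Proof. by rewrite wval_cons wval_nil mulg1. Qed.
Lemma wval_cat w w' : wval (w ++ w') = wval w * wval w'.
Proof. by rewrite /wval /word_val map_cat big_cat. Qed.
Lemma wval_rcons w l : wval (rcons w l) = wval w * lval l.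
Proof. by rewrite -cats1 wval_cat wval1. Qed.
Lemma lvalV l : lval (linv l) = (lval l)^-1.
Proof. by case: l => s [] /=; rewrite /lval /letter_val /= ?invgK. Qed.
Lemma wvalV w : wval (winv w) = (wval w)^-1.
Proof.
elim: w => [|l w IH]; first by rewrite /winv /= wval_nil invg1.
by rewrite /winv /= rev_cons wval_rcons -/(winv w) IH lvalV wval_cons invgM.
Qed.

Lemma wval_nf w : wval (nf w) = wval w.
Proof.
elim: w => //= l w; rewrite wval_cons => <-; case: (nf w) => [|l' w'].
  by rewrite wval1 wval_nil mulg1.
case: eqP => [->|_]; last by rewrite wval_cons.
by rewrite wval_cons lvalV mulVKg.
Qed.

Definition free_letters : Prop :=
  forall w, redw w -> w != [::] -> wval w <> 1.

(** If the words differ, cancel their common prefix: then the inverse of one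
    followed by the other is still reduced. *)
Lemma free_redw_inj w w' : free_letters -> redw w -> redw w' ->
  wval w = wval w' -> w = w'.
Proof.
move=> fx; elim: w w' => [|l w IH] [|l' w'] // rw rw'.
- by rewrite wval_nil => /esym /(fx _ rw' isT).
- by rewrite wval_nil => /(fx _ rw isT).
have [<-|ne] := eqVneq l l'.
  rewrite !wval_cons => /mulgI eqv; congr (_ :: _).
  by apply: IH eqv; [exact: redw_behead rw | exact: redw_behead rw'].
move=> eqv; exfalso.
have rc : redw (winv (l' :: w') ++ l :: w).
  rewrite /winv /= rev_cons; apply: redw_cat => //; last by rewrite linvK.
  by rewrite -rev_cons; apply: redw_winv rw'.
apply: (fx _ rc); first by rewrite -size_eq0 size_cat addnS.
by rewrite wval_cat wvalV eqv mulVg.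
Qed.

Lemma free_wval1 w : free_letters -> wval w = 1 -> nf w = [::].
Proof.
move=> fx w1; apply: (free_redw_inj fx) => //; first exact: redw_nf.
by rewrite wval_nf wval_nil.
Qed.

End Values.
End Words.

Arguments redw {S} w : simpl never.

(** * The Magnus expansion and the order on power series *)

Section PowerSeries.
Local Open Scope ring_scope.
Context {S : countType}.
Implicit Types (f g h : seq S -> int) (u v : seq S).

(** The product of noncommutative power series, by recursion on the monomial:
    the coefficients of the monomials starting with [s] form the left
    derivative, and the product rule for it makes every identity below a plain
    induction, with no sum over factorisations of the monomial. *)
Fixpoint conv f g u : int :=
  if u is s :: u' then f [::] * g u + conv (fun v => f (s :: v)) g u'
  else f [::] * g [::].

Definition ps1 u : int := (u == [::])%:R.

Lemma eq_conv f f' g g' : f =1 f' -> g =1 g' -> conv f g =1 conv f' g'.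
Proof.
move=> ff gg u; elim: u f f' ff => [|s u IH] f f' ff /=; first by rewrite ff gg.
by rewrite ff gg (IH _ (fun v => f' (s :: v))).
Qed.

Lemma conv0 g u : conv (fun=> 0) g u = 0.
Proof. by elim: u => [|s u IH] /=; rewrite ?IH mul0r ?add0r. Qed.

Lemma conv1s g u : conv ps1 g u = g u.
Proof. by case: u => [|s u] /=; rewrite mul1r // conv0 addr0. Qed.

Lemma conv_lin a f f' g u :
  conv (fun v => a * f v + f' v) g u = a * conv f g u + conv f' g u.
Proof. by elim: u f f' => [|s u IH] f f' /=; rewrite ?IH; ring. Qed.

Lemma convA f g h u : conv (conv f g) h u = conv f (conv g h) u.
Proof.
elim: u f => [|s u IH] f /=; first by rewrite mulrA.
by rewrite conv_lin IH; ring.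
Qed.

Lemma convN f g u : conv (fun v => - f v) g u = - conv f g u.
Proof. by elim: u f => [|s u IH] f /=; rewrite ?IH; ring. Qed.

(** Cross terms only occur above the lowest degree in which a nonconstant term
    of one of the factors appears. *)
Lemma conv_lowr f g u : u != [::] ->
  (forall v, v != [::] -> (size v < size u)%N -> g v = 0) ->
  conv f g u = f [::] * g u + f u * g [::].
Proof.
have low f' g' w : (forall v, v != [::] -> (size v <= size w)%N -> g' v = 0) ->
    conv f' g' w = f' w * g' [::].
  elim: w f' => //= s w IH f' g0; rewrite g0 // mulr0 add0r IH // => v vn sv.
  by apply: g0; rewrite // leqW.
by case: u => //= s u _ g0; rewrite low // => v vn sv; apply: g0.
Qed.

Lemma conv_lowl f g u : u != [::] ->
  (forall v, v != [::] -> (size v < size u)%N -> f v = 0) ->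
  conv f g u = f [::] * g u + f u * g [::].
Proof.
have low f' g' w : (forall v, (size v < size w)%N -> f' v = 0) ->
    conv f' g' w = f' w * g' [::].
  elim: w f' => //= s w IH f' g0; rewrite g0 // mul0r add0r IH // => v sv.
  by apply: g0.
by case: u => //= s u _ g0; rewrite low // => v sv; apply: g0.
Qed.

(** Any linear order of the monomials which refines the degree would serve:
    conjugation preserves the whole part of lowest degree of a series minus
    its constant term. *)
Definition mlt v u : bool :=
  (size v < size u)%N || (size v == size u) && (choice.pickle v < choice.pickle u)%N.

Lemma mlt_total u v : mlt u v || ((u == v) || mlt v u).
Proof.
rewrite /mlt; case: (ltngtP (size u) (size v)) => //= _; first by rewrite orbT.
by case: (ltngtP (choice.pickle u) (choice.pickle v)) => [||/(pcan_inj (@choice.pickleK _)) ->] //=; rewrite ?eqxx ?orbT.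
Qed.

Lemma mlt_size v u : mlt v u -> (size v <= size u)%N.
Proof. by case/orP => [/ltnW //|/andP[/eqP ->]]. Qed.

Definition lead f u : Prop :=
  [/\ u != [::], f u != 0 & forall v, v != [::] -> mlt v u -> f v = 0].

Definition pspos f : Prop := exists2 u, lead f u & 0 < f u.

Lemma lead_exists f u : u != [::] -> f u != 0 -> exists v, lead f v.
Proof.
move=> un fu.
pose A := fun n => `[< exists v, [/\ v != [::], f v != 0 & size v = n] >].
have exA : exists n, A n by exists (size u); apply/asboolP; exists u.
case: (ex_minnP exA) => n /asboolP[v [vn fv sv]] nmin.
pose B := fun k => `[< exists v, [/\ v != [::], f v != 0, size v = n & choice.pickle v = k] >].
have exB : exists k, B k by exists (choice.pickle v); apply/asboolP; exists v.
case: (ex_minnP exB) => k /asboolP[w [wn fw sw pw]] kmin.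
exists w; split=> // t tn mt; apply: contrapT => /eqP ft.
case/orP: mt => [lt|/andP[/eqP st lt]].
  have /nmin : A (size t) by apply/asboolP; exists t.
  by rewrite leqNgt -sw lt.
have /kmin : B (choice.pickle t) by apply/asboolP; exists t; rewrite st.
by rewrite leqNgt -pw lt.
Qed.

Lemma pspos_conv f g : f [::] = 1 -> g [::] = 1 ->
  pspos f -> pspos g -> pspos (conv f g).
Proof.
move=> f1 g1 [u [un fu lu] fu0] [v [vn gv lv] gv0].
have cE w : w != [::] -> (size w <= size u)%N || (size w <= size v)%N ->
    conv f g w = f w + g w.
  move=> wn /orP[] sw.
    rewrite conv_lowl ?f1 ?g1 ?mul1r ?mulr1 1?addrC // => t tn st.
    by apply: lu => //; rewrite /mlt (leq_trans st sw).
  rewrite conv_lowr ?f1 ?g1 ?mul1r ?mulr1 1?addrC // => t tn st.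
  by apply: lv => //; rewrite /mlt (leq_trans st sw).
have tr a b c : mlt a b -> mlt b c -> mlt a c by rewrite /mlt; lia.
case/or3P: (mlt_total u v) => [uv|/eqP uv|vu].
- have cu : conv f g u = f u by rewrite cE ?leqnn // lv // addr0.
  exists u; rewrite ?cu //; split; rewrite ?cu // => w wn wu.
  by rewrite cE ?(mlt_size wu) // lu ?lv //; apply: tr uv.
- subst v; have cu : conv f g u = f u + g u by rewrite cE ?leqnn.
  exists u; rewrite ?cu ?addr_gt0 //; split; rewrite ?cu ?gt_eqF ?addr_gt0 // => w wn wu.
  by rewrite cE ?(mlt_size wu) // lu ?lv.
- have cv : conv f g v = g v by rewrite cE ?leqnn ?orbT // lu // add0r.
  exists v; rewrite ?cv //; split; rewrite ?cv // => w wn wv.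
  by rewrite cE ?(mlt_size wv) ?orbT // lv ?lu //; apply: tr vu.
Qed.

(** Conjugation does not change the nonconstant part of lowest degree: this is
    what makes the order on the group two-sided. *)
Lemma pspos_conj f g h : f [::] = 1 -> g [::] = 1 -> h [::] = 1 ->
  conv h f =1 conv g h -> pspos f -> pspos g.
Proof.
move=> f1 g1 h1 hfg [u [un fu lu] fu0].
have fg v : v != [::] -> (size v <= size u)%N -> g v = f v.
  have [n] := ubnP (size v); elim: n v => // n IH v /ltnSE svn vn sv.
  have flow t : t != [::] -> (size t < size v)%N -> f t = 0.
    by move=> tn st; apply: lu => //; rewrite /mlt (leq_trans st sv).
  have := hfg v; rewrite conv_lowr // (conv_lowl h) //.
    by rewrite h1 g1 f1 !mul1r !mulr1 [RHS]addrC => /addIr.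
  by move=> t tn st; rewrite IH ?flow // ?(leq_trans st) // (leq_trans (ltnW st)).
exists u; rewrite ?fg //; split; rewrite ?fg // => v vn vu.
by rewrite fg ?lu // (mlt_size vu).
Qed.

Lemma pspos_or_inv f g u : f [::] = 1 -> g [::] = 1 -> conv f g =1 ps1 ->
  u != [::] -> f u != 0 -> pspos f \/ pspos g.
Proof.
move=> f1 g1 fg un fu; have [v [vn fv lv]] := lead_exists un fu.
have gE w : w != [::] -> (size w <= size v)%N -> g w = - f w.
  move=> wn sw; apply/eqP; rewrite -addr_eq0.
  have := fg w; rewrite conv_lowl //; last first.
    by move=> t tn st; apply: lv => //; rewrite /mlt (leq_trans st sw).
  by rewrite f1 g1 mul1r mulr1 /ps1 (negbTE wn) => ->.
case: (ltgtP (f v) 0) fv => // fv _; last by left; exists v => //; split; rewrite ?gt_eqF.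
right; exists v; rewrite ?gE ?oppr_gt0 //; split; rewrite ?gE ?oppr_eq0 ?lt_eqF // => w wn wv.
by rewrite gE ?(mlt_size wv) // lv ?oppr0.
Qed.

(** The Magnus expansion: [s] goes to 1 + s and its inverse to
    1 - s + s^2 - ... *)
Definition mgen (s : S) u : int := ((u == [::]) || (u == [:: s]))%:R.
Definition mgenV (s : S) u : int := if all (pred1 s) u then (-1) ^+ size u else 0.
Definition mletter (l : S * bool) := if l.2 then mgenV l.1 else mgen l.1.
Definition magnus (w : seq (S * bool)) : seq S -> int :=
  foldr (fun l f => conv (mletter l) f) ps1 w.

Lemma mletter_conv_nil l f : conv (mletter l) f [::] = f [::].
Proof. by case: l => s []; rewrite /= /mletter /= /mgen /mgenV /= ?mul1r. Qed.

Lemma mletter_conv l f t u : conv (mletter l) f (t :: u) =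
  f (t :: u) + (if t == l.1 then (if l.2 then - conv (mletter l) f u else f u) else 0).
Proof.
case: l => s [] /=; rewrite /mletter /=.
  rewrite {1}/mgenV /= mul1r; congr (_ + _).
  case: eqP => [->|ne].
    rewrite -convN; apply: eq_conv => // v; rewrite /mgenV /= eqxx.
    by case: all; rewrite ?oppr0 // exprS mulN1r.
  rewrite -[RHS](conv0 f u); apply: eq_conv => // v; rewrite /mgenV /=.
  by case: eqP.
rewrite {1}/mgen /= mul1r; congr (_ + _).
case: eqP => [->|ne].
  by rewrite -[RHS]conv1s; apply: eq_conv => // v; rewrite /mgen /ps1 /= eqseq_cons eqxx.
rewrite -[RHS](conv0 f u); apply: eq_conv => // v; rewrite /mgen /= eqseq_cons.
by case: eqP.
Qed.

Arguments conv : simpl never.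

Lemma mletterK l f : conv (mletter l) (conv (mletter (linv l)) f) =1 f.
Proof.
move=> u; elim: u => [|t u IH]; first by rewrite !mletter_conv_nil.
rewrite !mletter_conv /=; case: eqP => _; last by rewrite !addr0.
by case: l IH => s [] /= IH; [rewrite IH addrK | rewrite subrK].
Qed.

Lemma magnus_nil w : magnus w [::] = 1.
Proof. by elim: w => //= l w IH; rewrite mletter_conv_nil. Qed.

Lemma magnus_cat w w' : magnus (w ++ w') =1 conv (magnus w) (magnus w').
Proof.
elim: w => [|l w IH] u /=; first by rewrite conv1s.
by rewrite convA; apply: eq_conv.
Qed.

Lemma magnus_nf w : magnus (nf w) =1 magnus w.
Proof.
elim: w => //= l w IH u; rewrite -(eq_conv (frefl _) IH u).
case: (nf w) => [|l' w'] //=; case: eqP => [->|_] //=.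
by rewrite mletterK.
Qed.

Arguments magnus : simpl never.

Lemma magnusE l w : magnus (l :: w) = conv (mletter l) (magnus w).
Proof. by []. Qed.

Definition alternating u : bool := sorted (fun s t => s != t) u.

(** The reason why the Magnus expansion is faithful. For a reduced word with
    syllables at the letters s_1, ..., s_k the coefficient of the monomial s_1
    ... s_k is the product of the exponents, while longer alternating monomials
    do not occur. In the induction on letters, [u] is s_2 ... s_k, and the sign
    condition says that the exponent of the first syllable has the sign of its
    letters, so that it grows in absolute value when one more such letter is
    added. *)
Lemma magnus_alternating l w : redw (l :: w) ->
  exists u, [/\ alternating (l.1 :: u), magnus (l :: w) u != 0,
    0 < (if l.2 then -1 else 1) * magnus (l :: w) (l.1 :: u) * magnus (l :: w) u,
    forall v, alternating v -> ((size u).+1 < size v)%N -> magnus (l :: w) v = 0 &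
    forall v, alternating v -> (size u < size v)%N -> head l.1 v != l.1 ->
       magnus (l :: w) v = 0].
Proof.
have altb s u : alternating (s :: u) -> alternating u by case: u => //= t u /andP[].
have althd s u : alternating (s :: u) -> u = [::] \/ head s u != s.
  by case: u => [|t u] /=; [left | rewrite eq_sym => /andP[]; right].
(* on alternating monomials both kinds of letters act in the same way, up to sign *)
have step k w' t u : alternating (t :: u) -> magnus (k :: w') (t :: u) =
    magnus w' (t :: u) + (if t == k.1 then (if k.2 then -1 else 1) * magnus w' u else 0).
  move=> alt; rewrite magnusE mletter_conv; congr (_ + _); case: eqP => // tk.
  case: k.2; rewrite ?mul1r // mulN1r; congr (- _).
  case: u alt => [|t' u] alt; rewrite ?mletter_conv_nil // mletter_conv.
  by move: alt; rewrite -tk eq_sym /= => /andP[/negbTE -> _]; rewrite addr0.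
elim: w l => [|l' w IH] l rw.
  exists [::]; split=> //=.
  - by rewrite magnus_nil.
  - rewrite magnus_nil magnusE mletter_conv eqxx !mletter_conv_nil /ps1 /= add0r.
    by case: l.2; rewrite ?mulN1r ?opprK ?mul1r ?mulr1.
  - by case=> [|t [|t' v]] // alt _; rewrite step //= /ps1 mulr0 add0r if_same.
  - case=> [|t v] // alt _ /= /negbTE tl.
    by have := step l [::] t v alt; rewrite /= tl addr0 => ->.
have [u [altu nz pos long longh]] := IH l' (redw_behead rw).
have eps2 (b : bool) (a : int) : (if b then -1 else 1) * ((if b then -1 else 1) * a) = a.
  by case: b; rewrite ?mulN1r ?opprK ?mul1r.
have uE k w' v : alternating (k.1 :: v) -> magnus (k :: w') v = magnus w' v.
  case: v => [|t v] alt; first by rewrite !magnus_nil.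
  rewrite step ?(altb _ _ alt) //.
  by case: (althd _ _ alt) => //= /negbTE ->; rewrite addr0.
move: rw; rewrite redw_cons => /andP[ne rw].
have [ll|ll] := eqVneq l'.1 l.1.
  (* the first syllable gets one letter longer *)
  have l2 : l'.2 = l.2.
    move: ne ll; clear; case: l l' => [s b] [s' b'] /= + ss.
    by rewrite ss /linv xpair_eqE eqxx /=; case: b b' => [] [].
  rewrite ll l2 in altu pos longh; exists u; split=> //.
  - by rewrite (uE l).
  - rewrite (step l) // eqxx (uE l) // mulrDr mulrDl eps2.
    by rewrite ltr_pwDl // -expr2 sqr_ge0.
  - case=> [|t v] // alt sv; rewrite (step l) // long // add0r; case: eqP => // tl.
    case: v alt sv => [|t' v] // alt sv.
    have := althd _ _ alt; rewrite tl => -[//|hd].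
    by rewrite longh ?mulr0 ?(altb _ _ alt).
  - case=> [|t v] // alt sv /= tl; rewrite (step l) // (negbTE tl) addr0 longh //.
(* a new syllable *)
have alt' : alternating (l.1 :: l'.1 :: u) by rewrite /= eq_sym ll.
have nz' : magnus (l' :: w) (l'.1 :: u) != 0.
  by apply: contraTneq pos => ->; rewrite mulr0 mul0r ltxx.
exists (l'.1 :: u); split=> //.
- by rewrite (uE l).
- rewrite (step l) // eqxx (uE l) // long // add0r eps2.
  by rewrite -expr2 lt_neqAle sqr_ge0 eq_sym sqrf_eq0 nz'.
- case=> [|t v] // alt sv; rewrite (step l) // (long (t :: v)) ?(ltnW sv) // add0r; case: eqP => // _.
  by rewrite long ?mulr0 ?(altb _ _ alt).
- case=> [|t v] // alt sv /= tl; rewrite (step l) // (negbTE tl) addr0 long //.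
Qed.

Lemma magnus_faithful w : redw w -> w != [::] -> exists2 u, u != [::] & magnus w u != 0.
Proof.
case: w => // l w rw _; have [u [_ _ pos _ _]] := magnus_alternating rw.
by exists (l.1 :: u) => //; apply: contraTneq pos => ->; rewrite mulr0 mul0r ltxx.
Qed.

End PowerSeries.

(** * A bi-invariant order on a free group and on the edges of its Cayley tree *)

Section EdgeOrder.
Local Open Scope group_scope.
Context {G : groupType} {S : countType} (x : S -> G).
Context (fx : free_letters x).
Implicit Types (l : S * bool) (w : seq (S * bool)) (g h : G) (e f : G * S).

Local Notation wval := (wval x).
Local Notation lval := (lval x).

Definition gpos g : Prop := exists2 w, wval w = g & pspos (magnus w).

Lemma gpos_mul g h : gpos g -> gpos h -> gpos (g * h).
Proof.
move=> [w <- pw] [w' <- pw']; exists (w ++ w'); first by rewrite wval_cat.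
by rewrite (funext (magnus_cat w w')); apply: pspos_conv; rewrite ?magnus_nil.
Qed.

Lemma magnus_eq1 w : wval w = 1 -> magnus w =1 ps1.
Proof. by move=> w1 u; rewrite -magnus_nf (free_wval1 fx w1). Qed.

Lemma gpos_neq1 g : gpos g -> g <> 1.
Proof.
move=> [w wg [u [un fu _] _]] g1; move: fu.
by rewrite magnus_eq1 ?wg // /ps1 (negbTE un) eqxx.
Qed.

Lemma gpos_conj w g : gpos g -> gpos (wval w * g * (wval w)^-1).
Proof.
move=> [w' <- pw']; exists (w ++ w' ++ winv w).
  by rewrite !wval_cat wvalV mulgA.
apply: (pspos_conj (h := magnus w) _ _ _ _ pw'); rewrite ?magnus_nil // => u.
rewrite -!magnus_cat -magnus_nf -[RHS]magnus_nf; congr (magnus _ u).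
apply: (free_redw_inj fx); rewrite ?redw_nf // !wval_nf !wval_cat wvalV.
by rewrite !mulgA mulgVK.
Qed.

Lemma gpos_total w : wval w <> 1 -> gpos (wval w) \/ gpos (wval w)^-1.
Proof.
move=> w1; have nfn : nf w != [::].
  by apply/eqP => nf0; apply: w1; rewrite -wval_nf nf0 wval_nil.
have [u un fu] := magnus_faithful (redw_nf w) nfn; rewrite magnus_nf in fu.
have inv : conv (magnus w) (magnus (winv w)) =1 ps1.
  by move=> v; rewrite -magnus_cat magnus_eq1 // wval_cat wvalV mulgV.
have := pspos_or_inv (magnus_nil w) (magnus_nil (winv w)) inv un fu.
by move=> [p|p]; [left; exists w | right; exists (winv w); rewrite ?wvalV].
Qed.

Lemma free_torsion_free w n : wval w <> 1 -> wval w ^+ n.+1 <> 1.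
Proof.
have posX g k : gpos g -> gpos (g ^+ k.+1).
  by move=> pg; elim: k => [|k IH] //; rewrite expgS; apply: gpos_mul.
move=> /gpos_total[p|p]; first exact: (gpos_neq1 (posX _ n p)).
move: (gpos_neq1 (posX _ n p)).
by rewrite expVgn => ne w1; apply: ne; rewrite w1 invg1.
Qed.

(** Edges of the Cayley tree of [x]: [(g, s)] stands for the edge from [g] to
    [g * x s].  The order compares labels first, since two different edges with
    the same label have different origins. *)
Definition elt e f : Prop :=
  (choice.pickle e.2 < choice.pickle f.2)%N \/
  e.2 = f.2 /\ gpos (e.1^-1 * f.1).

Definition etrans h e : G * S := (h * e.1, e.2).

(** An inverse letter runs through its edge backwards, so that the edge has its
    origin at the far end. *)
Definition cedge g l : G * S := if l.2 then (g * (x l.1)^-1, l.1) else (g, l.1).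

Fixpoint cedges g w : seq (G * S) :=
  if w is l :: w' then cedge g l :: cedges (g * lval l) w' else [::].

Lemma elt_irr e : ~ elt e e.
Proof. by case=> [|[_ /gpos_neq1]]; rewrite ?ltnn // mulVg. Qed.

Lemma elt_trans f e e' : elt e f -> elt f e' -> elt e e'.
Proof.
move=> [lt|[eq p]] [lt'|[eq' p']].
- by left; apply: ltn_trans lt'.
- by left; rewrite -eq'.
- by left; rewrite eq.
- right; split; first by rewrite eq.
  by have := gpos_mul p p'; rewrite !mulgA mulgK.
Qed.

Lemma elt_etrans h e f : elt e f -> elt (etrans h e) (etrans h f).
Proof.
case=> [lt|[eq p]]; [by left | right; split=> //=].
by rewrite invgM mulgA mulgVK.
Qed.

Lemma cedge_trans h g l : etrans h (cedge g l) = cedge (h * g) l.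
Proof. by case: l => s [] /=; rewrite /cedge /etrans //= mulgA. Qed.

Lemma cedgeV g l : cedge (g * lval l) (linv l) = cedge g l.
Proof.
by case: l => s []; rewrite /cedge /lval /letter_val //= ?mulgK.
Qed.

Lemma cedge_inj g h l : cedge g l = cedge h l -> g = h.
Proof. by case: l => s []; rewrite /cedge /= => -[] // /mulIg. Qed.

Lemma cedge_label g h l l' : cedge g l = cedge h l' -> l' = l \/ l' = linv l.
Proof.
case: l l' => [s b] [s' b']; rewrite /cedge /linv /=.
by case: b b' => [] [] /= [_ ->]; [left | right | right | left].
Qed.

Lemma cedges_cat g w w' :
  cedges g (w ++ w') = cedges g w ++ cedges (g * wval w) w'.
Proof.
elim: w g => [|l w IH] g /=; first by rewrite wval_nil mulg1.
by rewrite IH wval_cons mulgA.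
Qed.

Lemma mem_cedges_winv g w : cedges (g * wval w) (winv w) =i cedges g w.
Proof.
elim: w g => [|l w IH] g e //=.
rewrite /winv /= rev_cons -cats1 cedges_cat mem_cat -/(winv w) wvalV /= inE.
by rewrite wval_cons mulgA IH mulgK cedgeV inE orbC.
Qed.

Lemma cedge_origin w l : exists w', cedge (wval w) l = (wval w', l.1).
Proof.
case: l => s []; rewrite /cedge /=; last by exists w.
by exists (rcons w (s, true)); rewrite wval_rcons.
Qed.

(** This is where conjugation invariance of the order is used. *)
Lemma elt_down g w l : gpos g^-1 -> elt (cedge (g * wval w) l) (cedge (wval w) l).
Proof.
move=> neg; rewrite -cedge_trans; have [w' ->] := cedge_origin w l.
right; split=> //=; have := gpos_conj (winv w') neg.
by rewrite wvalV invgK invgM.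
Qed.

Lemma elt_total w w' l l' : cedge (wval w) l <> cedge (wval w') l' ->
  elt (cedge (wval w) l) (cedge (wval w') l') \/
  elt (cedge (wval w') l') (cedge (wval w) l).
Proof.
have [v ->] := cedge_origin w l; have [v' ->] := cedge_origin w' l'.
move=> ne; rewrite /elt /=.
case: (ltngtP (choice.pickle l.1) (choice.pickle l'.1)).
- by left; left.
- by right; left.
move=> /(pcan_inj (@choice.pickleK S)) ll.
have ne1 : wval (winv v ++ v') <> 1.
  rewrite wval_cat wvalV => /mulg1_eq; rewrite invgK => vv.
  by apply: ne; rewrite ll vv.
case: (gpos_total ne1); rewrite wval_cat wvalV ?invgM ?invgK => p.
  by left; right.
by right; right.
Qed.

(** Otherwise the part of the path between the two passages through the edge
    would contain a nonempty reduced word of value 1. *)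
Lemma cedge_notin g l w : redw (l :: w) -> cedge g l \notin cedges (g * lval l) w.
Proof.
move=> rw; apply/negP => mem.
have split h w' e : e \in cedges h w' -> exists w1 l' w2,
    w' = w1 ++ l' :: w2 /\ e = cedge (h * wval w1) l'.
  elim: w' h => // k w' IH h /=; rewrite inE => /orP[/eqP ->|/IH[w1 [l' [w2 [-> ->]]]]].
    by exists [::], k, w'; rewrite wval_nil mulg1.
  by exists (k :: w1), l', w2; rewrite wval_cons mulgA.
have [w1 [l' [w2 [wE eE]]]] := split _ _ _ mem.
have r1 : redw (l :: w1).
  by move: rw; rewrite wE /redw /= cat_path => /andP[].
case: (cedge_label eE) => ll; rewrite ll in eE wE.
  apply: (fx r1) => //; have /eqP := cedge_inj eE.
  by rewrite -mulgA -[X in X == _]mulg1 => /eqP /mulgI; rewrite wval_cons => <-.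
move: eE; rewrite -[cedge g l]cedgeV => /cedge_inj /eqP.
rewrite -[X in X == _]mulg1 => /eqP /mulgI /esym w11.
have [w10|w1n] := eqVneq w1 [::].
  by move: rw; rewrite wE w10 cat0s redw_cons eqxx.
exact: (fx (redw_behead r1) w1n).
Qed.

(** The path starts at the value of a word [w0] because the order is only total
    on the group generated by the letters. *)
Lemma cedges_max w0 w : redw w -> w != [::] -> exists w1 l w2, w = w1 ++ l :: w2 /\
  forall e, e \in cedges (wval w0) w1 ++ cedges (wval w0 * wval w1 * lval l) w2 ->
    elt e (cedge (wval w0 * wval w1) l).
Proof.
elim: w w0 => // l w IH w0 rw _.
case: w IH rw => [|k w] IH rw; first by exists [::], l, [::].
have [w1 [m [w2 [wE wmax]]]] := IH (rcons w0 l) (redw_behead rw) isT.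
have [] := @elt_total w0 (rcons w0 l ++ w1) l m.
- rewrite wval_cat wval_rcons => eqe; have := cedge_notin (wval w0) rw.
  by rewrite eqe wE cedges_cat mem_cat /= in_cons eqxx orbT.
- rewrite wval_cat wval_rcons => lt; exists (l :: w1), m, w2; split; first by rewrite wE.
  rewrite !wval_rcons in wmax; rewrite wval_cons !mulgA /= => e.
  by rewrite inE => /orP[/eqP ->|/wmax].
- rewrite wval_cat wval_rcons => lt; exists [::], l, (k :: w); split=> // e.
  rewrite wval_nil mulg1 wE cedges_cat /= mem_cat inE orbCA => /orP[/eqP -> //|].
  rewrite !wval_rcons in wmax; rewrite -mem_cat => /wmax h; exact: elt_trans lt.
Qed.

End EdgeOrder.

(** * Subgroups, labelled graphs and their loop groups *)

Section Subgroups.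
Local Open Scope group_scope.
Local Open Scope classical_set_scope.
Context {G : groupType}.
Implicit Types (H K X : set G) (g h : G).

Lemma subgroupP H : subgroup H <-> H 1 /\ forall g h, H g -> H h -> H (g * h^-1).
Proof.
split=> [[H1 HD]|[H1 HD]].
  split=> [|g h Hg Hh]; first by have := H1; rewrite /= inE.
  by have := HD g h; rewrite /= !inE; apply.
by split=> [|g h]; rewrite /= !inE //; apply: HD.
Qed.

Lemma subgroup1 H : subgroup H -> H 1.
Proof. by move=> /subgroupP[]. Qed.

Lemma subgroupV H g : subgroup H -> H g -> H g^-1.
Proof. by move=> /subgroupP[H1 HD] Hg; rewrite -[_^-1]mul1g; apply: HD. Qed.

Lemma subgroupM H g h : subgroup H -> H g -> H h -> H (g * h).
Proof.
move=> sH Hg Hh; rewrite -[h]invgK; have /subgroupP[_ HD] := sH.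
by apply: HD => //; apply: subgroupV.
Qed.

Lemma subgroupI H K : subgroup H -> subgroup K -> subgroup (H `&` K).
Proof.
move=> /subgroupP[H1 HD] /subgroupP[K1 KD]; apply/subgroupP.
by split=> // g h [Hg Kg] [Hh Kh]; split; [apply: HD | apply: KD].
Qed.

Lemma generated_subgroup X : subgroup (generated X).
Proof.
apply/subgroupP; split=> [K [/subgroup1 //]|g h Xg Xh K KX].
have /subgroupP[_ KD] := KX.1.
by apply: KD; [apply: Xg | apply: Xh].
Qed.

Lemma generated_min X H : subgroup H -> X `<=` H -> generated X `<=` H.
Proof. by move=> sH XH g; apply. Qed.

Lemma sub_generated X : X `<=` generated X.
Proof. by move=> g Xg K [_]; apply. Qed.

Lemma generated_word X g : generated X g ->
  exists2 w : seq (G * bool), (forall l, l \in w -> X l.1) & word_val w = g.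
Proof.
pose W := [set g | exists2 w : seq (G * bool),
  (forall l, l \in w -> X l.1) & word_val w = g].
have wvE (w : seq (G * bool)) : wval id w = word_val w.
  by rewrite /wval; congr word_val; elim: w => //= -[s b] w ->.
suff: generated X `<=` W by apply.
apply: generated_min => [|h Xh].
  apply/subgroupP; split=> [|_ _ [w Xw <-] [w' Xw' <-]].
    by exists [::] => //; rewrite -wvE wval_nil.
  exists (w ++ winv w') => [l|]; last by rewrite -!wvE wval_cat wvalV.
  rewrite mem_cat mem_rev => /orP[/Xw //|/mapP[l' /Xw' Xl' ->]] //.
exists [:: (h, false)] => [l|]; first by rewrite inE => /eqP ->.
by rewrite -wvE wval1.
Qed.

Lemma wval_generated (S : eqType) (x : S -> G) H w : subgroup H ->
  (forall l, l \in w -> H (x l.1)) -> H (wval x w).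
Proof.
move=> sH; elim: w => [|l w IH] Hw; first by rewrite wval_nil; apply: subgroup1.
rewrite wval_cons; apply: subgroupM => //; last first.
  by apply: IH => k kw; apply: Hw; rewrite inE kw orbT.
have := Hw l; rewrite mem_head /lval /letter_val => /(_ isT).
by case: l.2 => //=; apply: subgroupV.
Qed.

Definition entry (s : seq G) (i : 'I_(size s)) : G := nth 1 s i.

Lemma entry_word (s : seq G) (w : seq (G * bool)) :
  (forall l, l \in w -> l.1 \in s) ->
  exists w' : seq ('I_(size s) * bool), [seq (entry l.1, l.2) | l <- w'] = w.
Proof.
elim: w => [|[g b] w IH] sw; first by exists [::].
have [|w' w'E] := IH; first by move=> l lw; apply: sw; rewrite inE lw orbT.
have gs : (index g s < size s)%N by rewrite index_mem (sw (g, b)) // mem_head.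
exists ((Ordinal gs, b) :: w') => /=.
by rewrite w'E /entry nth_index // -index_mem.
Qed.

Lemma generated_entry (s : seq G) :
  generated [set` s] = [set g | exists w, wval (@entry s) w = g].
Proof.
apply/seteqP; split=> g.
  by move=> /generated_word[w /entry_word[w' w'E] wg]; exists w'; rewrite /wval w'E.
move=> [w <-]; apply: wval_generated; first exact: generated_subgroup.
by move=> l _; apply: sub_generated; rewrite /= mem_nth.
Qed.

End Subgroups.

Section Graphs.
Local Open Scope group_scope.
Local Open Scope classical_set_scope.
Context {G : groupType} {S : finType} (x : S -> G).

Local Notation wval := (wval x).
Local Notation lval := (lval x).

Section OneGraph.
Context {V : finType}.
Implicit Types (E : {set V * S * V}) (u v t : V) (l : S * bool) (w : seq (S * bool)).

(** Inverse letters run through their edge backwards.  With this convention each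
    edge is seen from both of its ends, and the two directions need no separate
    treatment. *)
Definition eg u l v : V * S * V := if l.2 then (v, l.1, u) else (u, l.1, v).

Lemma egV u l v : eg v (linv l) u = eg u l v.
Proof. by case: l => s []. Qed.

Lemma eg_edge (e : V * S * V) : eg e.1.1 (e.1.2, false) e.2 = e.
Proof. by case: e => [[u s] v]. Qed.

Lemma eg_inj u l v u' l' v' : eg u l v = eg u' l' v' ->
  [/\ u = u', l = l' & v = v'] \/ [/\ u = v', l' = linv l & v = u'].
Proof.
case: l l' => [s b] [s' b']; rewrite /eg /=.
by case: b b' => [] [] [-> -> ->]; by [left | right].
Qed.

Fixpoint walk E u w v : Prop :=
  if w is l :: w' then exists2 t, eg u l t \in E & walk E t w' v else u = v.

Lemma walk_cat E u v t w w' : walk E u w v -> walk E v w' t -> walk E u (w ++ w') t.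
Proof.
by elim: w u => [|l w IH] u /= => [->|[r re /IH h] /h]; last by exists r.
Qed.

Lemma walk_catE E u t w w' : walk E u (w ++ w') t ->
  exists2 v, walk E u w v & walk E v w' t.
Proof.
elim: w u => [|l w IH] u /=; first by exists u.
by move=> [r re /IH[v wv w'v]]; exists v => //; exists r.
Qed.

Lemma walk1 E u l v : eg u l v \in E -> walk E u [:: l] v.
Proof. by exists v. Qed.

Lemma walk_rcons E u v t w l : walk E u w v -> eg v l t \in E -> walk E u (rcons w l) t.
Proof. by rewrite -cats1 => wv /walk1; apply: walk_cat. Qed.

Lemma walk_winv E u w v : walk E u w v -> walk E v (winv w) u.
Proof.
elim: w u => [|l w IH] u /=; first by move=> ->.
move=> [r re /IH h]; rewrite /winv /= rev_cons.
by apply: walk_rcons h _; rewrite egV.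
Qed.

Definition folded E : Prop := forall u l v v', eg u l v \in E -> eg u l v' \in E -> v = v'.

Lemma folded_walk_nf E u w v : folded E -> walk E u w v -> walk E u (nf w) v.
Proof.
move=> fE; elim: w u => //= l w IH u [r re /IH]; case: (nf w) => [|l' w'] /=.
  by move=> <-; exists r.
move=> [t te wt]; case: eqP => [ll|_]; last by exists r => //; exists t.
by rewrite -egV in re; rewrite ll in te; rewrite (fE _ _ _ _ re te).
Qed.

Definition linked E u v : set G := [set g | exists2 w, walk E u w v & wval w = g].

Lemma linkedM E u v t g h : linked E u v g -> linked E v t h -> linked E u t (g * h).
Proof.
move=> [w wv <-] [w' wt <-]; exists (w ++ w'); last by rewrite wval_cat.
exact: walk_cat wv wt.
Qed.

Lemma linkedV E u v g : linked E u v g -> linked E v u g^-1.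
Proof. by move=> [w wv <-]; exists (winv w); [apply: walk_winv | rewrite wvalV]. Qed.

Lemma linked_eg E u l v : eg u l v \in E -> linked E u v (lval l).
Proof. by move=> e; exists [:: l]; [apply: walk1 | rewrite wval1]. Qed.

Definition loops E v : set G := linked E v v.

Lemma loops_subgroup E v : subgroup (loops E v).
Proof.
apply/subgroupP; split=> [|g h Lg Lh]; first by exists [::]; rewrite ?wval_nil.
by apply: linkedM Lg _; apply: linkedV.
Qed.

Definition connected_on (VS : {set V}) E v0 : Prop :=
  [/\ v0 \in VS, forall u l v, eg u l v \in E -> u \in VS
    & forall v, v \in VS -> exists w, walk E v0 w v].

Lemma walk_exit E (W : {set V}) u w v : walk E u w v -> u \in W -> v \notin W ->
  exists u' l v', [/\ u' \in W, v' \notin W & eg u' l v' \in E].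
Proof.
elim: w u => [|l w IH] u /=; first by move=> -> ->.
move=> [r re wr] uW vW; have [rW|rW] := boolP (r \in W); first exact: IH wr rW vW.
by exists u, l, r.
Qed.

(** A maximal tree, grown one edge at a time; [t v] is the value of the path in
    the tree from the base vertex to [v]. *)
Lemma spanning_tree VS E v0 : connected_on VS E v0 ->
  exists (t : V -> G) (T : {set V * S * V}),
  [/\ T \subset E, #|T|.+1 = #|VS|, t v0 = 1,
      forall v, v \in VS -> linked E v0 v (t v)
    & forall u l v, eg u l v \in T -> t u * lval l = t v].
Proof.
move=> [v0S endS conn].
have tree k : (k < #|VS|)%N -> exists (t : V -> G) (T : {set V * S * V}) (W : {set V}),
    [/\ [/\ W \subset VS, v0 \in W, #|W| = k.+1 & T \subset E],
      #|T| = k, t v0 = 1, forall v, v \in W -> linked E v0 v (t v)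
    & forall u l v, eg u l v \in T -> u \in W /\ t u * lval l = t v].
  elim: k => [|k IH] lk.
    exists (fun=> 1), finset.set0, (finset.set1 v0); rewrite cards1 cards0 finset.sub1set v0S finset.sub0set.
    split=> // [|v|u l v]; rewrite ?inE // => /eqP ->.
    by exists [::]; rewrite ?wval_nil.
  have [t [T [W [[WS v0W cW TE] cT t0 tW tT]]]] := IH (ltnW lk).
  have [v vS vW] : exists2 v, v \in VS & v \notin W.
    apply/subsetPn; apply: contraL lk => SW.
    by rewrite -leqNgt -cW subset_leq_card.
  have [w /walk_exit/(_ v0W vW)[u [l [r [uW rW e]]]]] := conn v vS.
  have rS : r \in VS by apply: (endS r (linv l) u); rewrite egV.
  have rv y : y \in W -> (y == r) = false by apply: contraTF => /eqP ->.
  have eT : eg u l r \notin T.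
    apply: contra rW; rewrite -egV => /tT[] //.
  exists (fun y => if y == r then t u * lval l else t y), (eg u l r |: T)%SET, (r |: W)%SET.
  rewrite (rv _ v0W) !cardsU1 rW eT cW cT !inE v0W orbT.
  split=> //.
  - by split=> //; rewrite finset.subUset finset.sub1set ?rS ?e.
  - move=> v'; rewrite !inE; case: eqP => /= [->|_] => [_|/tW //].
    by apply: linkedM (linked_eg e); apply: tW.
  - move=> u' l' v'; rewrite !inE => /orP[/eqP/eg_inj|T'].
      move=> [[-> -> ->]|[-> ll ->]]; rewrite ?uW ?eqxx ?orbT (rv u) //.
      by rewrite ll lvalV mulgVK.
    have [u'W <-] := tT _ _ _ T'; have v'W : v' \in W by move: T'; rewrite -egV => /tT[].
    by rewrite u'W orbT !rv.
have c0 : (0 < #|VS|)%N by apply/card_gt0P; exists v0.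
have [|t [T [W [[WS v0W cW TE] cT t0 tW tT]]]] := tree #|VS|.-1; first by rewrite prednK.
have WE : W = VS by apply/eqP; rewrite eqEcard WS cW prednK ?leqnn.
exists t, T; split=> //; first by rewrite cT prednK.
  by rewrite -WE.
by move=> u l v /tT[].
Qed.

(** Each edge outside a maximal tree gives one generator: the loop which goes to
    the edge and comes back from it in the tree. *)
Lemma loops_generated VS E v0 : connected_on VS E v0 ->
  exists X : seq G, (size X + #|VS| = #|E|.+1)%N /\ generated [set` X] = loops E v0.
Proof.
move=> conn; have [t [T [TE cT t0 tV tT]]] := spanning_tree conn.
have [v0S endS _] := conn.
pose X := [seq t e.1.1 * x e.1.2 * (t e.2)^-1 | e <- enum (E :\: T)].
exists X; split.
  rewrite size_map -cardE -cT addnS cardsD (finset.setIidPr TE) subnK //.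
  exact: subset_leq_card.
apply/seteqP; split.
  apply: generated_min; first exact: loops_subgroup.
  move=> _ /mapP[[[u s] v] + ->]; rewrite mem_enum !inE => /andP[_ e] /=.
  have e' : eg u (s, false) v \in E by [].
  have e'' : eg v (s, true) u \in E by [].
  apply: linkedM (linkedV (tV v (endS _ _ _ e''))).
  by apply: linkedM (tV u (endS _ _ _ e')) (linked_eg e').
have sX := generated_subgroup [set` X].
have step u l v : eg u l v \in E -> generated [set` X] (t u * lval l * (t v)^-1).
  move=> e; have [eT|eT] := boolP (eg u l v \in T).
    by rewrite (tT _ _ _ eT) mulgV; apply: subgroup1.
  have Xe : generated [set` X] (t (eg u l v).1.1 * x (eg u l v).1.2 * (t (eg u l v).2)^-1).
    by apply: sub_generated; apply: map_f; rewrite mem_enum inE eT.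
  case: l {e eT} Xe => s [] //= /(subgroupV sX).
  by rewrite /lval /letter_val /= !invgM invgK mulgA.
suff gen u w v : walk E u w v -> generated [set` X] (t u * wval w * (t v)^-1).
  by move=> _ [w /gen + <-]; rewrite t0 invg1 mulg1 mul1g.
elim: w u => [|l w IH] u /=; first by move=> ->; rewrite wval_nil mulg1 mulgV; apply: subgroup1.
move=> [r /step e /IH h]; rewrite wval_cons.
by have := subgroupM sX e h; rewrite !mulgA mulgVK.
Qed.

End OneGraph.
End Graphs.

(** * Stallings folding *)

Section Folding.
Local Open Scope group_scope.
Local Open Scope classical_set_scope.
Context {G : groupType} {S : finType} (x : S -> G).

Local Notation wval := (wval x).
Local Notation linked := (linked x).
Local Notation loops := (loops x).

Section Fold.
Context {V : finType}.
Implicit Types (VS : {set V}) (E : {set V * S * V}).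

(** A single Stallings fold: two edges with the same label leaving the same
    vertex [u] are identified, and with them their ends [a] and [b].  A path of
    the folded graph lifts because [a] and [b] are linked through [u] by a path
    of value 1. *)
Lemma fold_once VS E v0 u l a b : connected_on VS E v0 ->
  eg u l a \in E -> eg u l b \in E -> a != b -> b != v0 ->
  exists E', [/\ connected_on (VS :\ b)%SET E' v0, loops E' v0 = loops E v0 & (#|E'| < #|E|)%N].
Proof.
move=> [v0S endS conn] ea eb ab bv0.
pose f v := if v == b then a else v.
pose fe (e : V * S * V) := (f e.1.1, e.1.2, f e.2).
have feE p k q : fe (eg p k q) = eg (f p) k (f q) by case: k => s [].
have feP e p k q : fe e = eg p k q -> exists p' q', [/\ e = eg p' k q', f p' = p & f q' = q].
  case: e k => [[y s] z] [s' c]; rewrite /fe /eg /=.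
  by case: c => [[<- <- <-]|[<- <- <-]]; [exists z, y | exists y, z].
have fv0 : f v0 = v0 by rewrite /f eq_sym (negbTE bv0).
pose E' := [set fe e | e in E]%SET.
have walk_f p w q : walk E p w q -> walk E' (f p) w (f q).
  elim: w p => [|k w IH] p /=; first by move=> ->.
  by move=> [r re /IH h]; exists (f r) => //; rewrite -feE; apply: imset_f.
exists E'; split.
- split; first by rewrite !inE eq_sym bv0.
    move=> p k q /imsetP[e eE /esym/feP[p' [q' [eq <- _]]]].
    rewrite eq in eE; rewrite !inE /f; case: (p' =P b) => [_|/eqP -> /=]; last exact: endS eE.
    by rewrite ab; apply: (endS a (linv l) u); rewrite egV.
  move=> v; rewrite !inE => /andP[vb /conn[w wv]]; exists w.
  by have := walk_f _ _ _ wv; rewrite fv0 {1}/f (negbTE vb).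
- apply/seteqP; split=> g.
    suff lift w p q p' q' : walk E' p w q -> f p' = p -> f q' = q ->
        linked E p' q' (wval w) by move=> [w /lift + <-]; apply; apply: fv0.
    have link_ab : linked E a b 1.
      exists [:: linv l; l]; last by rewrite wval_cons wval1 lvalV mulVg.
      by exists u; [rewrite egV | exists b].
    elim: w p p' => [|k w IH] p p' /=.
      move=> -> <-; rewrite wval_nil /f.
      case: eqP => [->|_]; case: eqP => [->|_] //.
      + by exists [::]; rewrite ?wval_nil.
      + by move=> <-.
      + by move=> ->; rewrite -invg1; apply: linkedV.
      + by move=> ->; exists [::]; rewrite ?wval_nil.
    move=> [r /imsetP[e eE /esym/feP[p1 [r1 [eq fp1 fr1]]]] /IH h] fp' fq'.
    rewrite wval_cons -[lval x k * _]mul1g.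
    apply: (linkedM (v := p1)); last first.
      apply: (linkedM (v := r1)); last exact: h.
      by apply: linked_eg; rewrite -eq.
    move: fp' fp1; rewrite /f; case: eqP => [->|_]; case: eqP => [->|_].
    + by exists [::]; rewrite ?wval_nil.
    + by move=> <- ->; rewrite -invg1; apply: linkedV.
    + by move=> -> <-.
    + by move=> -> ->; exists [::]; rewrite ?wval_nil.
  by move=> [w wv <-]; exists w => //; rewrite -fv0; apply: walk_f.
- have neq : eg u l a != eg u l b.
    by apply: contra ab => /eqP/eg_inj[[_ _ -> //]|[_ /eqP]]; rewrite eq_sym (negbTE (linv_neq l)).
  rewrite (cardsD1 (eg u l b) E) eb ltnS.
  apply: leq_trans (leq_imset_card fe _); apply: subset_leq_card.
  apply/fintype.subsetP => _ /imsetP[e eE ->].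
  have [->|ne] := eqVneq e (eg u l b); last by apply: imset_f; rewrite !inE ne.
  have -> : fe (eg u l b) = fe (eg u l a).
    by rewrite !feE /f eqxx (negbTE ab).
  by apply: imset_f; rewrite !inE neq.
Qed.

(** Each fold removes one vertex and at least one edge, so that the difference
    of their numbers does not grow. *)
Lemma fold_graph VS E v0 : connected_on VS E v0 -> exists VS' E',
  [/\ connected_on VS' E' v0, folded E', loops E' v0 = loops E v0
    & (#|E'| + #|VS| <= #|E| + #|VS'|)%N].
Proof.
have [n] := ubnP #|VS|; elim: n VS E => // n IH VS E /ltnSE leVS conn.
have [fE|] := pselect (folded E); first by exists VS, E.
move=> /existsNP[u /existsNP[l /existsNP[a /existsNP[b /not_implyP[ea /not_implyP[eb /eqP ab]]]]]].
wlog bv0 : a b ea eb ab / b != v0.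
  move=> wl; have [bv0|bv0] := eqVneq b v0; last exact: (wl a b).
  by apply: (wl b a) => //; rewrite 1?eq_sym // -bv0 eq_sym.
have [E1 [conn1 loops1 lt1]] := fold_once conn ea eb ab bv0.
have bS : b \in VS.
  by have [_ endS _] := conn; apply: (endS b (linv l) u); rewrite egV.
have cVS := cardsD1 b VS; rewrite bS in cVS.
have [|VS2 [E2 [conn2 f2 loops2 le2]]] := IH _ E1 _ conn1; first by rewrite cVS in leVS.
by exists VS2, E2; split=> //; [rewrite loops2 | rewrite cVS; lia].
Qed.

End Fold.

(** A bouquet of circles, one for each word, subdivided into letters: [None] is
    the centre and [Some (i, j)] the [j]-th inner vertex of the [i]-th circle. *)
Lemma bouquet (ws : seq (seq (S * bool))) :
  exists (V : finType) (VS : {set V}) (E : {set V * S * V}) (v0 : V),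
  [/\ connected_on VS E v0, loops E v0 = generated [set` [seq wval w | w <- ws]]
    & (#|E| < #|VS| + size ws)%N].
Proof.
pose n := size ws; pose M := (\max_(w <- ws) size w)%N.+1.
pose wd (i : 'I_n) := nth [::] ws i.
have wdM i : (size (wd i) < M)%N.
  by rewrite ltnS /wd (big_nth [::]) big_mkord (leq_bigmax i).
pose vtx (i : 'I_n) (j : nat) : option ('I_n * 'I_M) :=
  if (0 < j < size (wd i))%N then Some (i, inord j) else None.
pose D := [set p : 'I_n * 'I_M | (p.2 < size (wd p.1))%N]%SET.
pose fe (p : 'I_n * 'I_M) :=
  omap (fun l => eg (vtx p.1 p.2) l (vtx p.1 p.2.+1)) (onth (wd p.1) p.2).
pose E := [set e | Some e \in fe @: D]%SET.
pose VS := (None |: [set Some p | p in D & (0 < p.2)%N])%SET.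
have inE_E i j l : onth (wd i) j = Some l -> eg (vtx i j) l (vtx i j.+1) \in E.
  move=> lj; have ji : (j < size (wd i))%N by rewrite -onthTE lj.
  have jM := ltn_trans ji (wdM i).
  rewrite inE; apply/imsetP; exists (i, Ordinal jM); first by rewrite inE.
  by rewrite /fe /= lj.
have EP u k v : eg u k v \in E -> exists i j l,
    onth (wd i) j = Some l /\ eg u k v = eg (vtx i j) l (vtx i j.+1).
  rewrite inE => /imsetP[[i j] _]; rewrite /fe /=.
  by case lj: onth => [l|] //= [->]; exists i, j, l.
have walk_take i j : (j <= size (wd i))%N -> walk E None (take j (wd i)) (vtx i j).
  elim: j => [|j IH] ji; first by rewrite take0.
  have := ji; rewrite -onthTE; case lj: onth => [l|] // _.
  rewrite (take_nth l) //; apply: walk_rcons (IH (ltnW ji)) _.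
  by rewrite (onth_nth l l _ _ lj); apply: inE_E.
have vtxVS i j : vtx i j \in VS.
  rewrite /vtx; case: ifP => [/andP[j0 ji]|_]; last by rewrite !inE.
  rewrite !inE; apply/imsetP; exists (i, inord j) => //.
  by rewrite !inE /= inordK ?ji // (ltn_trans ji (wdM i)).
exists (option ('I_n * 'I_M)), VS, E, None; split.
- split; first by rewrite !inE.
    by move=> u k v /EP[i [j [l [_ /eg_inj[[-> _ _]|[-> _ _]]]]]].
  move=> v; rewrite !inE => /orP[/eqP ->|/imsetP[[i j]]]; first by exists [::].
  rewrite !inE /= => /andP[ji j0] ->; exists (take j (wd i)).
  rewrite (_ : Some _ = vtx i j); first exact: walk_take (ltnW ji).
  by rewrite /vtx j0 ji inord_val.
- pose H := generated [set` [seq wval w | w <- ws]].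
  have sH : subgroup H := generated_subgroup _.
  have Hwd i : H (wval (wd i)).
    by apply: sub_generated; apply: map_f; rewrite mem_nth.
  apply/seteqP; split; last first.
    apply: generated_min; first exact: loops_subgroup.
    move=> g /(nthP 1)[i + <-]; rewrite size_map => ilt; rewrite (nth_map [::]) //.
    exists (wd (Ordinal ilt)) => //.
    have := @walk_take (Ordinal ilt) _ (leqnn _).
    by rewrite take_size /vtx ltnn andbF.
  (* [t v] is the value read along the circle on the way to [v] *)
  pose t (v : option ('I_n * 'I_M)) :=
    if v is Some (i, j) then wval (take j (wd i)) else 1.
  have tvtx i j : (j <= size (wd i))%N -> exists2 h, H h & wval (take j (wd i)) = h * t (vtx i j).
    move=> ji; rewrite /vtx; case: ifP => [/andP[j0 jlt]|] /=.
      exists 1; first exact: subgroup1.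
      by rewrite inordK ?mul1g // (ltn_trans jlt (wdM i)).
    move=> /negbT; rewrite negb_and -leqNgt leqn0 -leqNgt => /orP[/eqP ->|ij].
      by exists 1; rewrite ?take0 ?wval_nil ?mulg1 //; apply: subgroup1.
    by exists (wval (wd i)); rewrite ?mulg1 ?take_oversize.
  have step u k v : eg u k v \in E -> H (t u * lval x k * (t v)^-1).
    move=> /EP[i [j [l [lj eqe]]]].
    have ji : (j < size (wd i))%N by rewrite -onthTE lj.
    have Hl : H (t (vtx i j) * lval x l * (t (vtx i j.+1))^-1).
      have [h Hh hE] := tvtx i j (ltnW ji); have [h' Hh' hE'] := tvtx i j.+1 ji.
      move: hE'; rewrite (take_nth l) // wval_rcons hE.
      rewrite (onth_nth l l _ _ lj).
      move=> e; have -> : t (vtx i j) * lval x l = h^-1 * h' * t (vtx i j.+1).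
        by rewrite -mulgA -e !mulgA mulVg mul1g.
      by rewrite mulgK; exact: (subgroupM sH (subgroupV sH Hh) Hh').
    case: (eg_inj eqe) => -[-> kl ->]; first by rewrite kl.
    rewrite kl in Hl; move: Hl; rewrite lvalV => /(subgroupV sH).
    by rewrite !invgM !invgK mulgA.
  suff gen u w v : walk E u w v -> H (t u * wval w * (t v)^-1).
    by move=> _ [w /gen + <-]; rewrite /= invg1 mulg1 mul1g.
  elim: w u => [|k w IH] u /=; first by move=> ->; rewrite wval_nil mulg1 mulgV; apply: subgroup1.
  move=> [r /step e /IH h]; rewrite wval_cons.
  by have := subgroupM sH e h; rewrite !mulgA mulgVK.
- have cE : (#|E| <= #|D|)%N.
    apply: leq_trans (leq_imset_card fe D).
    rewrite -(card_imset (mem E) Some_inj); apply: subset_leq_card.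
    by apply/fintype.subsetP => _ /imsetP[e + ->]; rewrite inE.
  have cVS : #|VS| = #|[set p in D | (0 < p.2)%N]%SET|.+1.
    rewrite cardsU1 card_imset; last exact: Some_inj.
    by rewrite (_ : None \in _ = false) //; apply/negbTE/imsetP => -[].
  have cD : (#|D| <= #|[set p in D | (0 < p.2)%N]%SET| + n)%N.
    rewrite -(cardsID [set p : 'I_n * 'I_M | (0 < p.2)%N]%SET D) (_ : (D :&: _)%SET = [set p in D | (0 < p.2)%N]%SET); last first.
      by apply/setP => p; rewrite !inE.
    rewrite leq_add2l -[leqRHS]card_ord.
    have injD : {in (D :\: [set p : 'I_n * 'I_M | (0 < p.2)%N])%SET &, injective fst}.
      move=> [i j] [i' j']; rewrite !inE /= -!eqn0Ngt => /andP[/eqP j0 _] /andP[/eqP j'0 _] <-.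
      by congr (_, _); apply: val_inj; rewrite /= j0 j'0.
    by rewrite -(card_in_imset injD) max_card.
  by rewrite cVS addSn ltnS -/n (leq_trans cE cD).
Qed.

End Folding.

(** * Graphs with fewer edges than vertices *)

Section HalfEdges.
Context {S V : finType}.
Implicit Types (E : {set V * S * V}) (v : V).

Definition nbrs E v : {set (S * bool) * V} := [set p | eg v p.1 p.2 \in E].

Lemma sum_nbrs E : \sum_v #|nbrs E v| = (2 * #|E|)%N.
Proof.
under eq_bigr do rewrite -sum1dep_card big_mkcond /=.
rewrite pair_bigA /=.
pose h (q : (V * S * V) * bool) : V * ((S * bool) * V) :=
  if q.2 then (q.1.2, ((q.1.1.2, true), q.1.1.1)) else (q.1.1.1, ((q.1.1.2, false), q.1.2)).
rewrite (reindex h) /=; last first.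
  exists (fun p => (eg p.1 p.2.1 p.2.2, p.2.1.2)).
    by case=> [[[u s] w] []].
  by case=> [u [[s []] w]].
rewrite (eq_bigr (fun q : (V * S * V) * bool => if q.1 \in E then 1 else 0)%N); last first.
  by case=> [[[u s] w] []].
rewrite -(pair_bigA _ (fun e (b : bool) => if e \in E then 1 else 0)%N) /=.
under eq_bigr do rewrite sum_nat_const card_bool.
by rewrite -big_distrr /= -big_mkcond sum1_card.
Qed.

Definition erase E v := [set e in E | (e.1.1 != v) && (e.2 != v)].

Lemma erase_sub E v : erase E v \subset E.
Proof. by apply/fintype.subsetP => e; rewrite inE => /andP[]. Qed.

Lemma eg_erase E v u l t : eg u l t \in erase E v = [&& eg u l t \in E, u != v & t != v].
Proof. by case: l => s []; rewrite !inE //= [(_ != v) && _]andbC. Qed.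

Lemma card_erase E v : (#|E| <= #|erase E v| + #|nbrs E v|)%N.
Proof.
apply: leq_trans (_ : #|erase E v :|: [set eg v p.1 p.2 | p in nbrs E v]| <= _)%N; last first.
  by apply: leq_trans (leq_card_setU _ _) _; rewrite leq_add2l leq_imset_card.
apply: subset_leq_card; apply/fintype.subsetP => -[[u s] t] eE; rewrite !inE eE /=.
have [<-|_] := eqVneq u v.
  by apply/orP; right; apply/imsetP; exists ((s, false), t); rewrite ?inE.
have [<-|//] := eqVneq t v.
by apply/orP; right; apply/imsetP; exists ((s, true), u); rewrite ?inE.
Qed.

(** Since there are fewer edges than vertices, some vertex is isolated or a
    leaf.  A leaf is removed, and its lifts are attached again to the finite set
    for the remaining graph. *)
Lemma finite_closed_set (G : groupType) (x : S -> G) (VS : {set V}) E :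
  (forall u l v, eg u l v \in E -> u \in VS) -> (#|E| < #|VS|)%N ->
  exists A : seq (G * V), [/\ A != [::], forall p, p \in A -> p.2 \in VS &
    forall g u l v, (g, u) \in A -> eg u l v \in E -> ((g * lval x l)%g, v) \in A].
Proof.
have [n] := ubnP #|VS|; elim: n VS E => // n IH VS E /ltnSE leVS endS ltE.
have [v vS] : exists2 v, v \in VS & (#|nbrs E v| <= 1)%N.
  apply: contrapT => no; move: ltE; apply/negP; rewrite -leqNgt.
  rewrite -(leq_pmul2l (isT : 0 < 2)%N) -sum_nbrs mulnC -sum_nat_const.
  apply: (leq_trans (n := \sum_(v in VS) #|nbrs E v|)); last first.
    by rewrite big_mkcond leq_sum // => v _; case: ifP.
  apply: leq_sum => v vS; rewrite ltnNge; apply/negP => le1.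
  by apply: no; exists v.
rewrite leq_eqVlt ltnS leqn0 => /orP[/cards1P[[l0 u] nv]|/eqP/cards0_eq nv]; last first.
  exists [:: (1%g, v)]; split=> // [p|g u l t]; rewrite inE => /eqP; first by move=> ->.
  move=> [_ ->] e; have : (l, t) \in nbrs E v by rewrite inE.
  by rewrite nv inE.
have nvE l t : eg v l t \in E -> l = l0 /\ t = u.
  move=> e; have : (l, t) \in nbrs E v by rewrite inE.
  by rewrite nv inE => /eqP[-> ->].
have e0 : eg v l0 u \in E by have := finset.set11 (l0, u); rewrite -nv inE.
have uv : u != v.
  apply/eqP => uv; have := e0; rewrite uv -egV => /nvE[ll _].
  by have := linv_neq l0; rewrite ll eqxx.
have [|||A [A0 AV Acl]] := IH (VS :\ v) (erase E v).
- by have := cardsD1 v VS; rewrite vS; lia.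
- by move=> g1 l1 v1; rewrite eg_erase !inE => /and3P[/endS -> ->].
- have : (#|erase E v| < #|E|)%N.
    rewrite (cardsD1 (eg v l0 u) E) e0 ltnS; apply: subset_leq_card.
    apply/fintype.subsetP => e eE; rewrite !inE (fintype.subsetP (erase_sub E v) _ eE) andbT.
    by apply: contraTneq eE => ->; rewrite eg_erase eqxx andbF.
  by have := cardsD1 v VS; rewrite vS; lia.
have AN g t : (g, t) \in A -> t != v by move/AV; rewrite !inE => /andP[].
exists (A ++ [seq (p.1 * lval x (linv l0), v)%g | p <- A & p.2 == u]); split.
- by rewrite -size_eq0 size_cat addn_eq0 size_eq0 (negbTE A0).
- move=> p; rewrite mem_cat => /orP[/AV|/mapP[q _ ->] //].
  by rewrite !inE => /andP[].
move=> g w l t; rewrite !mem_cat => /orP[gA|/mapP[[g1 u1] + [gE wE]]] e; last first.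
  rewrite mem_filter /= => /andP[/eqP uu gA].
  rewrite uu in gA; rewrite wE in e; have [-> ->] := nvE _ _ e.
  by rewrite gE lvalV mulgVK gA.
have wv := AN _ _ gA; have [tv|tv] := eqVneq t v; last first.
  by rewrite (Acl g w) // eg_erase e wv.
move: e; rewrite tv -egV => /nvE[ll wu]; apply/orP; right; apply/mapP.
by exists (g, w); rewrite ?mem_filter /= ?wu ?eqxx -?wu // -ll linvK.
Qed.

End HalfEdges.

(** * Bridges: the upper bound *)

Section Bridges.
Local Open Scope group_scope.
Context {G : groupType} {S : finType} (x : S -> G).
Context (fx : free_letters x).

Local Notation wval := (wval x).
Local Notation lval := (lval x).
Local Notation elt := (elt x).
Local Notation cedge := (cedge x).
Local Notation cedges := (cedges x).

Section Letters.
Implicit Types (a : nat -> S * bool).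

Definition pval a i : G := wval (mkseq a i).

Lemma mkseqD a i j : mkseq a (i + j) = mkseq a i ++ mkseq (fun k => a (i + k)%N) j.
Proof. by rewrite /mkseq iotaD map_cat add0n -[i in iota i j]addn0 iotaDl -map_comp. Qed.

Lemma mkseqSl a i : mkseq a i.+1 = a 0%N :: mkseq (fun k => a k.+1) i.
Proof. by rewrite -add1n mkseqD. Qed.

Lemma pvalD a i j : pval a (i + j) = pval a i * pval (fun k => a (i + k)%N) j.
Proof. by rewrite /pval mkseqD wval_cat. Qed.

Lemma pval0 a : pval a 0 = 1. Proof. exact: wval_nil. Qed.

Lemma pvalS a i : pval a i.+1 = pval a i * lval (a i).
Proof. by rewrite -addn1 pvalD /pval /= wval1 addn0. Qed.

Definition redstream a : Prop := forall i, a i.+1 != linv (a i).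

Lemma redw_mkseq a n : redstream a -> redw (mkseq a n).
Proof.
elim: n a => [|n IH] a ra //; rewrite mkseqSl redw_cons IH ?andbT; last first.
  by move=> i; apply: ra.
by case: n {IH} => //= n; rewrite mkseqSl.
Qed.

Lemma pval_inj a : redstream a -> injective (pval a).
Proof.
move=> ra; suff lt i j : (i < j)%N -> pval a i <> pval a j.
  by move=> i j e; case: (ltngtP i j) => // /lt //; rewrite e.
move=> ij; rewrite -(subnKC ij) addSnnS pvalD -[X in X <> _]mulg1 => /mulgI/esym.
apply: (fx (redw_mkseq _ _)) => // k; by rewrite addnS; apply: ra.
Qed.

End Letters.

Section OneGraph.
Context {V : finType}.
Implicit Types (E : {set V * S * V}) (u v t : V) (l : S * bool) (g h : G) (f : G * S).

(** Here [f] is an edge of the Cayley tree, with which the edges of the path are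
    compared after it has been lifted to start at the vertex [g]. *)
Definition below E g v l f : Prop := exists (p : nat -> V) (a : nat -> S * bool),
  [/\ p 0%N = v, a 0%N = l, redstream a, forall i, eg (p i) (a i) (p i.+1) \in E
    & forall i, elt (cedge (g * pval a i) (a i)) f].

(** One half of a line with its maximum at the given edge.  The end [v] of the
    edge is recorded since the graph need not be folded. *)
Definition descends E u l v : Prop := eg u l v \in E /\
  exists2 l', l' != linv l & below E (lval l) v l' (cedge 1 l).

(** The two halves join to a line, since an edge and its reverse have the same
    lift to the Cayley tree. *)
Definition bridge E (e : V * S * V) : Prop :=
  descends E e.1.1 (e.1.2, false) e.2 /\ descends E e.2 (e.1.2, true) e.1.1.

Definition bridges E : {set V * S * V} := [set e | `[< bridge E e >]].

Lemma bridgesP E u l v :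
  eg u l v \in bridges E <-> descends E u l v /\ descends E v (linv l) u.
Proof.
rewrite inE; split=> [/asboolP|h]; first by case: l => s [] [].
by apply/asboolP; case: l h => s [] [].
Qed.

Lemma bridges_sub E : bridges E \subset E.
Proof.
by apply/fintype.subsetP => e; rewrite -[e]eg_edge => /bridgesP[[]].
Qed.

Lemma below_trans E h g v l f : below E g v l f -> below E (h * g) v l (etrans h f).
Proof.
move=> [p [a [p0 a0 ra pE pf]]]; exists p, a; split=> // i.
by rewrite -mulgA -cedge_trans; apply: elt_etrans.
Qed.

Lemma below_cons E g u l v l' f : eg u l v \in E -> l' != linv l -> elt (cedge g l) f ->
  below E (g * lval l) v l' f -> below E g u l f.
Proof.
move=> e ll' lf [p [a [p0 a0 ra pE pf]]].
pose a' i := if i is i'.+1 then a i' else l.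
exists (fun i => if i is i'.+1 then p i' else u), a'; split=> //.
- by case=> [|i] /=; [rewrite a0 | apply: ra].
- by case=> [|i] //=; rewrite p0.
case=> [|i] /=; first by rewrite pval0 mulg1.
by have := pf i; rewrite /pval mkseqSl /= wval_cons mulgA.
Qed.

Lemma below_cat E g u w v l f : walk E u w v -> redw (rcons w l) ->
  (forall e, e \in cedges g w -> elt e f) -> below E (g * wval w) v l f ->
  below E g u (head l w) f.
Proof.
elim: w g u => [|k w IH] g u /=; first by move=> -> _ _; rewrite wval_nil mulg1.
move=> [r re wr] rw ef; rewrite wval_cons mulgA => b.
have kf : elt (cedge g k) f by apply: ef; rewrite mem_head.
apply: (below_cons re _ kf (IH _ _ wr (redw_behead rw) _ b)).
  by case: w rw {IH wr ef b} => [|m w]; rewrite redw_cons => /andP[].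
by move=> e ew; apply: ef; rewrite inE ew orbT.
Qed.

Lemma seq_min (T : eqType) (R : T -> T -> Prop) (s : seq T) :
  (forall y z z' : T, R z y -> R y z' -> R z z') -> (forall y, ~ R y y) -> s != [::] ->
  exists2 y, y \in s & forall z, z \in s -> ~ R z y.
Proof.
move=> tr irr; elim: s => // y [|y' s] IH _.
  by exists y; rewrite ?mem_head // => z; rewrite inE => /eqP ->.
have [//|m ms mmin] := IH.
have [ym|nym] := pselect (R y m).
  exists y; first by rewrite mem_head.
  by move=> z; rewrite inE => /orP[/eqP ->//|/mmin nzm zy]; apply: nzm (tr _ _ _ zy ym).
exists m; first by rewrite inE ms orbT.
by move=> z; rewrite inE => /orP[/eqP ->//|/mmin].
Qed.

(** If the non-bridges leave a finite set closed in the covering graph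
    [G * V], its smallest exit is an edge at which no line has its maximum: a
    line through this edge enters the finite set and must leave it through
    another exit. *)
Lemma no_exit E (A : seq (G * V)) :
  (forall g u l v, (g, u) \in A -> eg u l v \in E :\: bridges E -> (g * lval l, v) \in A) ->
  forall g u l v, (g, u) \in A -> eg u l v \in E -> (g * lval l, v) \in A.
Proof.
move=> Acl g0 u0 l0 v0 gA0 e0; apply: contrapT => nA.
pose Ex := [seq z <- [seq (p, q) | p <- A, q <- enum {: (S * bool) * V}]
  | eg z.1.2 z.2.1 z.2.2 \in bridges E].
pose ce (z : (G * V) * ((S * bool) * V)) := cedge z.1.1 z.2.1.
have inEx g u l v : (g, u) \in A -> eg u l v \in bridges E -> (g, u, (l, v)) \in Ex.
  by move=> gA b; rewrite mem_filter /= b; apply/allpairsP; exists ((g, u), (l, v)); rewrite mem_enum.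
have Ex0 : Ex != [::].
  have b : eg u0 l0 v0 \in bridges E.
    by apply/negPn/negP => nb; apply: nA; apply: Acl gA0 _; rewrite inE nb.
  by apply/eqP => E0; have := inEx _ _ _ _ gA0 b; rewrite E0.
have [|z|[[g u] [l v]] zE zmin] := @seq_min _ (fun z z' => elt (ce z) (ce z')) Ex _ _ Ex0.
- by move=> y z t; apply: elt_trans.
- exact: elt_irr.
move: zE; rewrite mem_filter /= => /andP[/bridgesP[_ [_ [l' ll' b]]] /allpairsP[[p q] [/= pA _ [pE qE]]]].
have gA : (g, u) \in A by rewrite pE.
have [p' [a [p0 a0 ra pE' pf]]] := below_trans (g * lval l) b.
rewrite lvalV mulgK in p0 a0 ra pE' pf.
have {}pf i : elt (cedge (g * pval a i) (a i)) (cedge g l).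
  by have := pf i; rewrite cedge_trans mulg1 cedgeV.
have inA i : (g * pval a i, p' i) \in A.
  elim: i => [|i IH]; first by rewrite pval0 mulg1 p0.
  rewrite pvalS mulgA; apply: (Acl _ _ _ _ IH); rewrite inE pE' andbT; apply/negP => bi.
  exact: (zmin _ (inEx _ _ _ _ IH bi)) (pf i).
pose s := mkseq (fun i => (g * pval a i, p' i)) (size A).+1.
have us : uniq s by rewrite mkseq_uniq // => i j [/mulgI /(pval_inj ra)].
have : (size s <= size A)%N by apply: uniq_leq_size => // _ /mapP[i _ ->].
by rewrite size_mkseq ltnn.
Qed.

(** The upper bound on the number of bridges.  A component of the complement of
    the bridges which is a tree would be a finite closed set, hence would
    contain a whole component of the covering graph, on which the infinite group
    of loops acts freely. *)
Lemma card_bridges_le VS E v0 g : connected_on VS E v0 -> loops x E v0 g -> g <> 1 ->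
  (#|VS| + #|bridges E| <= #|E|)%N.
Proof.
move=> [v0S endS conn] [w0 w0v wg] g1.
rewrite addnC -leq_subRL ?subset_leq_card ?bridges_sub //.
have -> : (#|E| - #|bridges E| = #|E :\: bridges E|)%N.
  by rewrite cardsD (finset.setIidPr (bridges_sub E)).
rewrite leqNgt; apply/negP => lt.
have [|A [A0 AV Acl]] := finite_closed_set x _ lt.
  by move=> u l v; rewrite inE => /andP[_ /endS].
have {}Acl := no_exit Acl.
have Aw h u w v : (h, u) \in A -> walk E u w v -> (h * wval w, v) \in A.
  elim: w h u => [|l w IH] h u hA /=; first by move=> <-; rewrite wval_nil mulg1.
  by move=> [r re]; rewrite wval_cons mulgA; apply: IH; apply: Acl re.
case: A A0 AV Acl Aw => // -[h u] A _ AV Acl Aw.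
have [w wu] := conn u (AV _ (mem_head _ _)).
have hA := Aw _ _ _ _ (mem_head _ _) (walk_winv wu).
set h0 := h * _ in hA.
have powA i : (h0 * g ^+ i, v0) \in (h, u) :: A.
  elim: i => [|i IH]; first by rewrite mulg1.
  by rewrite expgSr mulgA -[X in (_ * X, _)]wg; apply: (Aw _ _ _ _ IH).
have inj : injective (fun i => (h0 * g ^+ i, v0)).
  suff lt' i j : (i < j)%N -> g ^+ i <> g ^+ j.
    by move=> i j [/mulgI e]; case: (ltngtP i j) => // /lt' //; rewrite e.
  move=> ij; rewrite -(subnKC ij) addSnnS expgnDr -[X in X <> _]mulg1 => /mulgI/esym.
  by rewrite -wg; apply: (free_torsion_free fx); rewrite wg.
pose s := mkseq (fun i => (h0 * g ^+ i, v0)) (size A).+2.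
have us : uniq s by apply: mkseq_uniq.
have : (size s <= size ((h, u) :: A))%N by apply: uniq_leq_size => // _ /mapP[i _ ->].
by rewrite size_mkseq ltnn.
Qed.

End OneGraph.

(** The edges of a line are compared through their labels alone, and these are
    preserved by maps of labelled graphs. *)
Lemma descends_map (V V' : finType) (f : V -> V') (E : {set V * S * V}) (E' : {set V' * S * V'}) :
  (forall u l v, eg u l v \in E -> eg (f u) l (f v) \in E') ->
  forall u l v, descends E u l v -> descends E' (f u) l (f v).
Proof.
move=> fE u l v [e [l' ll' [p [a [p0 a0 ra pE pf]]]]]; split; first exact: fE.
exists l' => //; exists (fun i => f (p i)), a; split=> //; first by rewrite p0.
by move=> i; apply: fE.
Qed.

Lemma bridges_map (V V' : finType) (f : V -> V') (E : {set V * S * V}) (E' : {set V' * S * V'}) :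
  (forall u l v, eg u l v \in E -> eg (f u) l (f v) \in E') ->
  forall u l v, eg u l v \in bridges E -> eg (f u) l (f v) \in bridges E'.
Proof.
move=> fE u l v /bridgesP[d d']; apply/bridgesP.
by split; apply: (descends_map fE).
Qed.

Lemma bridges_mono (V : finType) (E E' : {set V * S * V}) :
  E \subset E' -> bridges E \subset bridges E'.
Proof.
move=> /fintype.subsetP sE; apply/fintype.subsetP => e; rewrite -[e]eg_edge.
by apply: (bridges_map (f := id)) => u l v; apply: sE.
Qed.

End Bridges.

(** * Bridges: the lower bound *)

Lemma next_neq (T : eqType) (s : seq T) y :
  uniq s -> (1 < size s)%N -> y \in s -> next s y != y.
Proof.
move=> us s1 ys; have [i s' si] := rot_to ys.
rewrite -(next_rot i us) si; have := us; rewrite -(rot_uniq i) si.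
have : (1 < size (y :: s'))%N by rewrite -si size_rot.
case: s' {si} => //= z s' _; rewrite eqxx inE negb_or eq_sym.
by move=> /andP[/andP[]].
Qed.

Section PeriodicPaths.
Local Open Scope group_scope.
Context {G : groupType} {S : finType} (x : S -> G).
Context (fx : free_letters x).
Context {V : finType}.
Implicit Types (E : {set V * S * V}) (u v t : V) (l : S * bool).

Local Notation wval := (wval x).
Local Notation lval := (lval x).
Local Notation elt := (elt x).
Local Notation cedge := (cedge x).
Local Notation cedges := (cedges x).
Local Notation pval := (pval x).

Definition periodic E (p : nat -> V) (a : nat -> S * bool) n : Prop :=
  [/\ (0 < n)%N, redstream a, forall i, eg (p i) (a i) (p i.+1) \in E,
      forall i, p (i + n)%N = p i & forall i, a (i + n)%N = a i].

Lemma periodic_mul E p a n k i : periodic E p a n ->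
  p (i + k * n)%N = p i /\ a (i + k * n)%N = a i.
Proof.
move=> [_ _ _ pn an]; elim: k => [|k [IHp IHa]]; first by rewrite addn0.
by rewrite mulSn addnCA addnC pn an.
Qed.

Lemma periodic_pvalD E p a n i : periodic E p a n -> pval a (n + i) = pval a n * pval a i.
Proof.
move=> [_ _ _ _ an]; rewrite pvalD; congr (_ * wval _).
by apply: eq_map => k; rewrite addnC an.
Qed.

Lemma periodic_neq1 E p a n : periodic E p a n -> pval a n <> 1.
Proof.
move=> [n0 ra _ _ _]; rewrite -(pval0 x a) => /(pval_inj fx ra) n00.
by rewrite n00 in n0.
Qed.

(** The closed path is run backwards: the index [n * i - i] is congruent to
    [- i] modulo the period. *)
Lemma periodic_rev E p a n : periodic E p a n -> exists p' a',
  [/\ periodic E p' a' n, p' 0%N = p 0%N, a' 0%N = linv (a n.-1)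
    & pval a' n = (pval a n)^-1].
Proof.
move=> per; have [n0 ra pE pn an] := per.
have idx i : (n * i.+1 - i.+1).+1 = (n * i - i + n)%N by nia.
exists (fun i => p (n * i - i)%N), (fun i => linv (a (n * i.+1 - i.+1)%N)).
split.
- split=> // i.
  + by rewrite linvK eq_sym; have := ra (n * i.+2 - i.+2)%N; rewrite idx an.
  + by have := pE (n * i.+1 - i.+1)%N; rewrite idx pn egV.
  + have -> : (n * (i + n) - (i + n) = n * i - i + (n - 1) * n)%N by nia.
    by case: (periodic_mul (n - 1) (n * i - i) per).
  + have -> : (n * (i + n).+1 - (i + n).+1 = n * i.+1 - i.+1 + (n - 1) * n)%N by nia.
    by case: (periodic_mul (n - 1) (n * i.+1 - i.+1) per) => _ ->.
- by rewrite muln0.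
- by rewrite muln1 subn1.
set a' := fun i => _.
have powE k i : pval a (k * n + i) = pval a n ^+ k * pval a i.
  elim: k => [|k IH]; first by rewrite mul0n mul1g.
  by rewrite mulSn -addnA (periodic_pvalD _ per) IH expgS mulgA.
have inv i : pval a n ^+ i * pval a' i = pval a (n * i - i).
  elim: i => [|i IH]; first by rewrite muln0 sub0n !pval0 mul1g.
  rewrite pvalS expgS -mulgA [_ ^+ i * _]mulgA IH mulgA -(periodic_pvalD _ per).
  by rewrite addnC -idx pvalS /a' lvalV mulgK.
have := inv n; have -> : (n * n - n = n.-1 * n + 0)%N by nia.
have -> : pval a n ^+ n = pval a n ^+ n.-1 * pval a n by rewrite -expgSr prednK.
by rewrite powE pval0 -mulgA => /mulgI/mulg1_eq ->.
Qed.

(** If the value of the period is negative in the bi-invariant order, then going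
    once more through the period moves each edge of the path down. *)
Lemma periodic_descending E p a n i : periodic E p a n -> gpos x (pval a n)^-1 ->
  (n <= i)%N -> exists2 e, e \in cedges 1 (mkseq a n) & elt (cedge (pval a i) (a i)) e.
Proof.
move=> per neg; have [n0 ra pE pn an] := per.
have step j : elt (cedge (pval a (j + n)) (a (j + n)%N)) (cedge (pval a j) (a j)).
  by rewrite an addnC (periodic_pvalD _ per); apply: elt_down.
have [k] := ubnP i; elim: k i => // k IH i /ltnSE ik ni.
pose j := (i - n)%N; have jE : i = (j + n)%N by rewrite subnK.
have [nj|jn] := leqP n j.
  have [|e eb lt] := IH j _ nj; first by lia.
  by exists e => //; apply: (elt_trans _ lt); rewrite jE.
exists (cedge (pval a j) (a j)); last by rewrite jE.
rewrite -(subnKC jn) addSnnS mkseqD cedges_cat mem_cat mul1g.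
by rewrite mkseqSl /= addn0 mem_head orbT.
Qed.

(** Two periodic paths which leave the same vertex by different letters and
    both descend form a line.  All its edges outside a finite segment are below
    edges of this segment, so that the line has a maximum, at a bridge. *)
Lemma bridge_of_periodic E p a n p' a' n' :
  periodic E p a n -> periodic E p' a' n' -> p 0%N = p' 0%N -> a 0%N != a' 0%N ->
  gpos x (pval a n)^-1 -> gpos x (pval a' n')^-1 -> exists e, e \in bridges x E.
Proof.
move=> per per' pp aa neg neg'.
have [n0 ra pE pn an] := per; have [n0' ra' pE' pn' an'] := per'.
have walk_mk (q : nat -> V) b k : (forall i, eg (q i) (b i) (q i.+1) \in E) ->
    walk E (q 0%N) (mkseq b k) (q k).
  move=> qE; elim: k => [|k IH] //; rewrite mkseqS.
  exact: walk_rcons IH (qE k).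
pose w0 := mkseq a n; pose W := winv w0 ++ mkseq a' n'.
have winvS b k : winv (mkseq b k.+1) = linv (b k) :: winv (mkseq b k).
  by rewrite mkseqS /winv map_rcons rev_rcons.
have rF : redw (winv (mkseq a n.+1) ++ mkseq a' n'.+1).
  rewrite mkseqSl {1}/winv /= rev_cons -/(winv _) [mkseq a' _]mkseqSl.
  have r1 := redw_winv (redw_mkseq n.+1 ra).
  apply: redw_cat; last by rewrite linvK eq_sym.
    by move: r1; rewrite mkseqSl {1}/winv /= rev_cons.
  by rewrite -mkseqSl redw_mkseq.
have FE : winv (mkseq a n.+1) ++ mkseq a' n'.+1 = linv (a n) :: rcons W (a' n').
  by rewrite winvS mkseqS -rcons_cat.
rewrite FE in rF.
have rW : redw W.
  by have := redw_behead rF; rewrite -cats1 /redw => /cat_sorted2[].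
have Wn : W != [::] by rewrite -size_eq0 size_cat addn_eq0 negb_and size_mkseq -!lt0n n0' orbT.
have [w1 [l [w2 [WE Wmax]]]] := cedges_max fx w0 rW Wn.
set g := wval w0 * wval w1 in Wmax.
set f := cedge g l in Wmax.
have valW : wval w0 * wval W = pval a' n' by rewrite wval_cat wvalV mulVKg.
have le_f e e' : e \in cedges (wval w0) W -> elt e' e -> elt e' f.
  rewrite WE cedges_cat /= mem_cat inE orbCA => /orP[/eqP -> //|].
  by rewrite -mem_cat => /Wmax h h'; apply: elt_trans h.
have inW e : (e \in cedges 1 (mkseq a n)) || (e \in cedges 1 (mkseq a' n')) ->
    e \in cedges (wval w0) W.
  rewrite cedges_cat mem_cat wvalV mulgV -/w0 -{1}(mem_cedges_winv x 1 w0) mul1g.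
  by [].
have tail q b k : periodic E q b k -> gpos x (pval b k)^-1 ->
    (forall e, e \in cedges 1 (mkseq b k) -> e \in cedges (wval w0) W) ->
    below x E (pval b k) (q k) (b k) f.
  move=> perq negq inq; exists (fun i => q (k + i)%N), (fun i => b (k + i)%N).
  have [k0 rb qE qk bk] := perq.
  split; rewrite ?addn0 // => i; rewrite ?addnS //.
  rewrite -pvalD; have [e eb lt] := periodic_descending perq negq (leq_addr i k).
  exact: le_f (inq _ eb) lt.
have [u wu [v e wv]] : exists2 u, walk E (p n) w1 u & walk E u (l :: w2) (p' n').
  apply: walk_catE; rewrite -WE; apply: walk_cat (walk_winv (walk_mk _ _ n pE)) _.
  by rewrite pp; apply: walk_mk.
exists (eg u l v); apply/bridgesP.
rewrite WE in rF; have hd k k' w : redw (k :: rcons w k') -> head k' w != linv k.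
  by case: w => [|m w]; rewrite redw_cons => /andP[].
have rR : redw (l :: rcons w2 (a' n')).
  by move: rF; rewrite rcons_cat /redw -cat_cons => /cat_sorted2[].
have rL : redw (linv l :: rcons (winv w1) (a n)).
  have : redw (rcons (linv (a n) :: w1) l).
    by move: rF; rewrite rcons_cat /redw rcons_cons -cat_rcons -cat_cons => /cat_sorted2[].
  by move=> /redw_winv; rewrite /winv map_rcons rev_rcons /= rev_cons linvK.
have bR : below x E (g * lval l) v (head (a' n') w2) f.
  apply: (below_cat wv (redw_behead rR)) => [e' e'w|].
    by apply: Wmax; rewrite mem_cat e'w orbT.
  rewrite (_ : _ * wval w2 = pval a' n'); last first.
    by rewrite -valW WE wval_cat wval_cons !mulgA.
  by apply: tail => // e' e'w; apply: inW; rewrite e'w orbT.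
have bL : below x E g u (head (a n) (winv w1)) f.
  apply: (below_cat (walk_winv wu) (redw_behead rL)) => [e'|].
    by rewrite mem_cedges_winv => e'w; apply: Wmax; rewrite mem_cat e'w.
  rewrite wvalV mulgK; apply: tail => // e' e'w; apply: inW; by rewrite e'w.
split; split; rewrite ?egV //.
  exists (head (a' n') w2); first exact: hd rR.
  by have := below_trans g^-1 bR; rewrite mulKg /f cedge_trans mulVg.
exists (head (a n) (winv w1)); first exact: hd rL.
have := below_trans (g * lval l)^-1 bL.
by rewrite /f -cedgeV cedge_trans mulVg invgM mulgVK lvalV.
Qed.

(** The successor of an edge [(u, (l, v))] in a fixed cyclic order of the edges
    at [v].  This is a permutation of the directed edges, so each of them lies
    on a closed path, which is reduced if no vertex is a leaf. *)
Definition turn E (d : V * ((S * bool) * V)) : V * ((S * bool) * V) :=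
  let: (u, (l, v)) := d in
  if eg u l v \in E then (v, next (enum (nbrs E v)) (linv l, u)) else d.

Definition dedge E (d : V * ((S * bool) * V)) : bool := eg d.1 d.2.1 d.2.2 \in E.

Lemma dedge_turn E d : dedge E (turn E d) = dedge E d.
Proof.
case: d => u [l v]; rewrite /turn; case: ifP => // e; rewrite {2}/dedge /= e.
have : next (enum (nbrs E v)) (linv l, u) \in nbrs E v.
  by rewrite -mem_enum mem_next mem_enum inE /= egV.
by rewrite inE.
Qed.

Lemma turn_inj E : injective (turn E).
Proof.
move=> d d' e; have := dedge_turn E d; rewrite e dedge_turn.
case: d d' e => u [l v] [u' [l' v']]; rewrite /turn /dedge /=.
case: ifP => _; case: ifP => _ // [<- /(can_inj (prev_next (enum_uniq _)))].
by move=> /pair_equal_spec[/(inv_inj linvK) -> ->].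
Qed.

Lemma periodic_turn E v l t : folded E -> (forall u k r, eg u k r \in E -> (1 < #|nbrs E r|)%N) ->
  (l, t) \in nbrs E v -> exists p a n k,
  [/\ periodic E p a n, p 0%N = v, a 0%N = l, k \in nbrs E v &
      a n.-1 = linv k.1 /\ next (enum (nbrs E v)) k = (l, t)].
Proof.
move=> fE deg; rewrite inE => e; pose d := (v, (l, t)).
pose D i := iter i (turn E) d; pose n := order (turn E) d.
have DE i : dedge E (D i).
  by elim: i => [|i IH]; [rewrite /dedge /= e | rewrite /D iterS dedge_turn].
have n0 : (0 < n)%N := order_gt0 _ _.
have Dn i : D (i + n)%N = D i.
  by rewrite /D iterD iter_order //; apply: turn_inj.
have DS i : (D i.+1).1 = (D i).2.2 /\ (D i.+1).2 =
    next (enum (nbrs E (D i).2.2)) (linv (D i).2.1, (D i).1).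
  have := DE i; rewrite (_ : D i.+1 = turn E (D i)) // /dedge.
  by case: (D i) => u' [l' v'] /= ->.
have rev i : (linv (D i).2.1, (D i).1) \in nbrs E (D i).2.2.
  by rewrite inE /= egV; apply: DE.
exists (fun i => (D i).1), (fun i => (D i).2.1), n, (linv (D n.-1).2.1, (D n.-1).1).
have Dpn : (D n.-1).2.2 = v /\ next (enum (nbrs E v)) (linv (D n.-1).2.1, (D n.-1).1) = (l, t).
  have := DS n.-1; rewrite prednK // -[n]add0n Dn /= => -[<- <-]; by [].
split=> //.
- split=> // [i|i|i|i]; rewrite ?Dn //.
  + have e1 := DE i; have e2 := DE i.+1; have [d1 d2] := DS i.
    (* by folding, a turn back by the inverse letter would repeat the edge *)
    rewrite /dedge d1 in e2; apply/eqP => ll; rewrite ll in e2.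
    have tt := fE _ _ _ _ e2 (_ : eg _ _ (D i).1 \in E); rewrite egV in tt.
    have := @next_neq _ (enum (nbrs E (D i).2.2)) (linv (D i).2.1, (D i).1).
    rewrite enum_uniq -cardE (deg _ _ _ e1) mem_enum rev -d2 => /(_ isT isT isT).
    by rewrite [(D i.+1).2]surjective_pairing ll tt ?eqxx.
  + have [-> _] := DS i; exact: DE.
- by have [<- _] := Dpn; apply: rev.
- by rewrite linvK; case: Dpn.
Qed.
(** After pruning leaves, some vertex [v] has degree at least 3.  Each edge at
    [v] starts a closed path which descends in one of its two directions, so the
    edge or its predecessor in the cyclic order at [v] starts a descending path.
    A single edge is the predecessor of only one other, so that at least two
    edges at [v] start descending paths. *)
Lemma bridge_exists (VS : {set V}) E : folded E -> (forall u l v, eg u l v \in E -> u \in VS) ->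
  (#|VS| < #|E|)%N -> exists e, e \in bridges x E.
Proof.
have [n] := ubnP #|VS|; elim: n VS E => // n IH VS E /ltnSE leVS fE endS ltE.
have [[v vS v1]|big] := pselect (exists2 v, v \in VS & (#|nbrs E v| <= 1)%N).
  have cVS := cardsD1 v VS; rewrite vS in cVS.
  have cE := card_erase E v.
  have sub := erase_sub E v.
  have [||||e eb] := IH (VS :\ v) (erase E v).
  - by lia.
  - by move=> u l t t' /(fintype.subsetP sub) e /(fintype.subsetP sub); apply: fE e.
  - by move=> u l t; rewrite eg_erase !inE => /and3P[/endS -> ->].
  - by lia.
  by exists e; apply: fintype.subsetP eb; apply: bridges_mono.
have {big IH} deg u k r : eg u k r \in E -> (1 < #|nbrs E r|)%N.
  rewrite -egV => /endS rS; rewrite ltnNge; apply/negP => r1.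
  by apply: big; exists r.
have [v v3] : exists v, (2 < #|nbrs E v|)%N.
  apply: contrapT => no; move: ltE; apply/negP; rewrite -leqNgt.
  rewrite -(leq_pmul2l (isT : 0 < 2)%N) -sum_nbrs [leqRHS]mulnC -sum_nat_const.
  rewrite [leqRHS]big_mkcond; apply: leq_sum => v _; case: ifP => [_|/negP vS].
    by rewrite leqNgt; apply/negP => v3; apply: no; exists v.
  rewrite leqn0 cards_eq0; apply/eqP/setP => -[l t]; rewrite !inE.
  by apply/negP => /endS.
pose D l := exists p a n, [/\ periodic E p a n, p 0%N = v, a 0%N = l & gpos x (pval a n)^-1].
have DP h : h \in nbrs E v ->
    D h.1 \/ exists k, [/\ k \in nbrs E v, next (enum (nbrs E v)) k = h & D k.1].
  case: h => l t hv; have [p [a [m [k [per p0 a0 kv [am nk]]]]]] := periodic_turn fE deg hv.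
  case: (gpos_total fx (periodic_neq1 per)) => pos; last by left; exists p, a, m.
  right; exists k; split=> //; have [p' [a' [per' p0' a0' val']]] := periodic_rev per.
  by exists p', a', m; rewrite p0' a0' am linvK val' invgK.
have [d [dv Dd]] : exists d, d \in nbrs E v /\ D d.1.
  have /card_gt0P[h hv] : (0 < #|nbrs E v|)%N by apply: ltn_trans v3.
  by case: (DP h hv) => [Dh|[k [kv _ Dk]]]; [exists h | exists k].
have [d' [d'v Dd' dd']] : exists d', [/\ d' \in nbrs E v, D d'.1 & d' != d].
  have /card_gt1P[h [h' [hv h'v hh']]] : (1 < #|nbrs E v :\ d|)%N.
    by have := cardsD1 d (nbrs E v); rewrite dv; lia.
  move: hv h'v; rewrite !inE => /andP[hd hv] /andP[h'd h'v].
  have [|Dh|[k [kv nk Dk]]] := DP h; [by rewrite inE | by exists h; rewrite inE |].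
  have [kd|] := eqVneq k d; last by exists k.
  have [|Dh'|[k' [k'v nk' Dk']]] := DP h'; [by rewrite inE | by exists h'; rewrite inE |].
  have [k'd|] := eqVneq k' d; last by exists k'.
  by move: hh'; rewrite -nk -nk' kd k'd eqxx.
move: dv d'v; rewrite !inE => dv d'v.
move: Dd Dd' => [p [a [m [per p0 a0 neg]]]] [p' [a' [m' [per' p0' a0' neg']]]].
apply: (bridge_of_periodic per per' _ _ neg neg'); first by rewrite p0 p0'.
rewrite a0 a0'; apply: contra dd' => /eqP ll; rewrite -ll in d'v.
by rewrite [d']surjective_pairing [d]surjective_pairing ll (fE _ _ _ _ dv d'v).
Qed.

(** Removing a bridge lowers the number of edges by one and creates no new
    bridge; when no bridge is left, there are at most as many edges as vertices. *)
Lemma card_bridges_ge (VS : {set V}) E : folded E -> (forall u l v, eg u l v \in E -> u \in VS) ->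
  (#|E| <= #|VS| + #|bridges x E|)%N.
Proof.
have [n] := ubnP #|E|; elim: n E => // n IH E /ltnSE leE fE endS.
have [le|lt] := leqP #|E| #|VS|; first exact: leq_trans (leq_addr _ _).
have [e eb] := bridge_exists fE endS lt.
have eE := fintype.subsetP (bridges_sub x E) _ eb.
have cE := cardsD1 e E; have cB := cardsD1 e (bridges x E); rewrite eE eb in cE cB.
have sub : E :\ e \subset E by apply: subD1set.
have IHe : (#|E :\ e| <= #|VS| + #|bridges x (E :\ e)|)%N.
  apply: IH => [|u l t t' /(fintype.subsetP sub) e1 /(fintype.subsetP sub)|u l t].
  - by lia.
  - exact: fE e1.
  - by move=> /(fintype.subsetP sub)/endS.
have : (#|bridges x (E :\ e)| <= #|bridges x E :\ e|)%N.
  apply: subset_leq_card; rewrite finset.subsetD1 bridges_mono //.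
  by apply/negP => /(fintype.subsetP (bridges_sub x _)); rewrite !inE eqxx.
by lia.
Qed.

End PeriodicPaths.

(** * The Hanna Neumann inequality *)

Section HannaNeumann.
Local Open Scope group_scope.
Local Open Scope classical_set_scope.
Context {G : groupType}.
Implicit Types (H K F : set G).

Definition generated_by H n : Prop :=
  exists2 X : seq G, (size X <= n)%N & generated [set` X] = H.

Section Pullback.
Context {S : finType} (x : S -> G) (fx : free_letters x).

Local Notation wval := (wval x).
Local Notation loops := (loops x).
Local Notation bridges := (bridges x).

Section FibreProduct.
Context {V1 V2 : finType} (E1 : {set V1 * S * V1}) (E2 : {set V2 * S * V2}).

Definition fibre : {set (V1 * V2) * S * (V1 * V2)} :=
  [set e | ((e.1.1.1, e.1.2, e.2.1) \in E1) && ((e.1.1.2, e.1.2, e.2.2) \in E2)]%SET.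

Lemma eg_fibre u l v :
  (eg u l v \in fibre) = (eg u.1 l v.1 \in E1) && (eg u.2 l v.2 \in E2).
Proof. by case: l => s []; rewrite inE. Qed.

Lemma walk_fibre u w v : walk E1 u.1 w v.1 -> walk E2 u.2 w v.2 -> walk fibre u w v.
Proof.
elim: w u => [|l w IH] u /=; first by case: u v => [u1 u2] [v1 v2] /= -> ->.
move=> [r1 e1 w1] [r2 e2 w2]; exists (r1, r2); last exact: IH.
by rewrite eg_fibre e1.
Qed.

Lemma fibre_walk u w v : walk fibre u w v -> walk E1 u.1 w v.1 /\ walk E2 u.2 w v.2.
Proof.
elim: w u => [|l w IH] u /=; first by move=> ->.
move=> [r]; rewrite eg_fibre => /andP[e1 e2] /IH[w1 w2].
by split; [exists r.1 | exists r.2].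
Qed.

Lemma folded_fibre : folded E1 -> folded E2 -> folded fibre.
Proof.
move=> f1 f2 u l v v'; rewrite !eg_fibre => /andP[e1 e2] /andP[e1' e2'].
by rewrite [v]surjective_pairing [v']surjective_pairing (f1 _ _ _ _ e1 e1') (f2 _ _ _ _ e2 e2').
Qed.

(** An element of both loop groups may be read along different words in the two
    graphs, but its reduced word is read in both since they are folded. *)
Lemma loops_fibre v : folded E1 -> folded E2 ->
  loops fibre v = loops E1 v.1 `&` loops E2 v.2.
Proof.
move=> f1 f2; apply/seteqP; split=> g.
  by move=> [w /fibre_walk[w1 w2] <-]; split; exists w.
move=> [[w1 h1 v1] [w2 h2 v2]].
have nf12 : nf w1 = nf w2.
  by apply: (free_redw_inj fx); rewrite ?redw_nf // !wval_nf v1 v2.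
exists (nf w1); last by rewrite wval_nf.
apply: walk_fibre; first exact: folded_walk_nf.
by rewrite nf12; apply: folded_walk_nf.
Qed.

Lemma card_bridges_fibre : (#|bridges fibre| <= #|bridges E1| * #|bridges E2|)%N.
Proof.
pose f (e : (V1 * V2) * S * (V1 * V2)) :=
  ((e.1.1.1, e.1.2, e.2.1), (e.1.1.2, e.1.2, e.2.2)).
have injf : injective f by move=> [[[u1 u2] s] [v1 v2]] [[[? ?] ?] [? ?]] [-> -> -> -> _ ->].
rewrite -cardsX -(card_imset _ injf); apply: subset_leq_card.
apply/fintype.subsetP => _ /imsetP[e eb ->]; move: eb.
rewrite -{1}[e]eg_edge finset.in_setX => eb.
have h1 u l v : eg u l v \in fibre -> eg u.1 l v.1 \in E1 by rewrite eg_fibre => /andP[].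
have h2 u l v : eg u l v \in fibre -> eg u.2 l v.2 \in E2 by rewrite eg_fibre => /andP[].
by apply/andP; split; [exact: (bridges_map h1 eb) | exact: (bridges_map h2 eb)].
Qed.

End FibreProduct.

Lemma component (V : finType) (E : {set V * S * V}) v0 : exists VS E',
  [/\ connected_on VS E' v0, E' \subset E & loops E' v0 = loops E v0].
Proof.
pose VS := [set v | `[< exists w, walk E v0 w v >]]%SET.
pose E' := [set e in E | (e.1.1 \in VS) && (e.2 \in VS)]%SET.
have VSP v : reflect (exists w, walk E v0 w v) (v \in VS).
  by rewrite inE; apply: asboolP.
have VS_eg u l v : eg u l v \in E -> u \in VS -> v \in VS.
  by move=> e /VSP[w wu]; apply/VSP; exists (rcons w l); apply: walk_rcons e.
have E'E u l v : (eg u l v \in E') = [&& eg u l v \in E, u \in VS & v \in VS].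
  by case: l => s []; rewrite [LHS]inE //= [(v \in _) && _]andbC.
have sub : E' \subset E by apply/fintype.subsetP => e; rewrite inE => /andP[].
have v0S : v0 \in VS by apply/VSP; exists [::].
have lift u w v : walk E u w v -> u \in VS -> walk E' u w v.
  elim: w u => [|l w IH] u //= [r e /IH h] uS; have rS := VS_eg _ _ _ e uS.
  by exists r; [rewrite E'E e uS | apply: h].
exists VS, E'; split=> //.
  split=> // [u l v|v /VSP[w wv]]; first by rewrite E'E => /and3P[].
  by exists w; apply: lift.
apply/seteqP; split=> g [w wv <-]; exists w => //; last exact: lift.
elim: w {1 3}v0 wv => [|l w IH] u //= [r e /IH h]; exists r => //.
exact: (fintype.subsetP sub).
Qed.

(** In a bouquet of [n] circles the number of edges exceeds that of vertices by
    at most [n - 1], and folding preserves this. *)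
Lemma few_bridges (ws : seq (seq (S * bool))) g :
  generated [set` [seq wval w | w <- ws]] g -> g <> 1 ->
  exists (V : finType) (E : {set V * S * V}) v0,
  [/\ folded E, loops E v0 = generated [set` [seq wval w | w <- ws]]
    & (#|bridges E| < size ws)%N].
Proof.
have [V [VS [E [v0 [conn <- lt]]]]] := bouquet x ws.
have [VS' [E' [conn' fE' <- le]]] := fold_graph x conn.
move=> Lg g1; exists V, E', v0; split=> //.
by have := card_bridges_le fx conn' Lg g1; lia.
Qed.

Lemma generated_nil : generated [set` [::]] = [set 1 : G].
Proof.
apply/seteqP; split=> [|_ ->]; last exact: (subgroup1 (generated_subgroup _)).
apply: generated_min => //; apply/subgroupP; split=> // _ _ -> ->.
by rewrite /= invg1 mulg1.
Qed.

Lemma hanna_neumann_words (ws1 ws2 : seq (seq (S * bool))) :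
  generated_by (generated [set` [seq wval w | w <- ws1]] `&`
                generated [set` [seq wval w | w <- ws2]])
    ((size ws1).-1 * (size ws2).-1).+1.
Proof.
set H := generated _; set K := generated _.
have [[g [Hg Kg] g1]|triv] := pselect (exists2 g, (H `&` K) g & g <> 1); last first.
  exists [::] => //; rewrite generated_nil; apply/seteqP; split=> [_ ->|g HKg].
    by apply: subgroup1; apply: subgroupI; apply: generated_subgroup.
  by apply: contrapT => g1; apply: triv; exists g.
have [V1 [E1 [v1 [f1 L1 b1]]]] := few_bridges Hg g1.
have [V2 [E2 [v2 [f2 L2 b2]]]] := few_bridges Kg g1.
have [VS [E [conn sub LE]]] := component (fibre E1 E2) (v1, v2).
have [X [sX gX]] := loops_generated x conn.
exists X; last by rewrite gX LE loops_fibre // L1 L2.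
have fE : folded E.
  move=> u l v v' /(fintype.subsetP sub) e /(fintype.subsetP sub).
  exact: (folded_fibre f1 f2 e).
have [_ endS _] := conn; have ge := card_bridges_ge fx fE endS.
have le : (#|bridges E| <= (size ws1).-1 * (size ws2).-1)%N.
  apply: leq_trans (subset_leq_card (bridges_mono x sub)) _.
  apply: leq_trans (card_bridges_fibre _ _) _.
  by apply: leq_mul; lia.
by lia.
Qed.

End Pullback.

(** A basis may be infinite, while the graphs are labelled by a finite type. *)
Lemma finite_letters (B : set G) (s : seq G) : (forall g, g \in s -> generated B g) ->
  exists2 L : seq G, (forall b, b \in L -> B b) &
    forall g, g \in s -> exists2 w : seq (G * bool),
      (forall l, l \in w -> l.1 \in L) & word_val w = g.
Proof.
elim: s => [|g s IH] gs; first by exists [::].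
have [|L BL Ls] := IH; first by move=> h hs; apply: gs; rewrite inE hs orbT.
have [w Bw wg] := generated_word (gs _ (mem_head _ _)).
exists (map fst w ++ L) => [b|h].
  by rewrite mem_cat => /orP[/mapP[l lw ->]|/BL //]; apply: Bw.
rewrite inE => /orP[/eqP ->|/Ls[w' Lw' w'h]].
  by exists w => // l lw; rewrite mem_cat map_f.
by exists w' => // l lw'; rewrite mem_cat Lw' ?orbT.
Qed.

Theorem hanna_neumann F H K n1 n2 : free_subgroup F -> H `<=` F -> K `<=` F ->
  generated_by H n1 -> generated_by K n2 ->
  generated_by (H `&` K) (n1.-1 * n2.-1).+1.
Proof.
move=> [_ [B [gB freeB]]] HF KF [hs shs gH] [ks sks gK].
have [g|L BL Lw] := @finite_letters B (hs ++ ks).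
  rewrite mem_cat gB => /orP[gh|gk].
    by apply: HF; rewrite -gH; apply: sub_generated.
  by apply: KF; rewrite -gK; apply: sub_generated.
pose x := @entry G (undup L).
have fx : free_letters x.
  move=> w rw wn; apply: freeB.
  - by move=> _ /mapP[l _ ->]; apply: BL; rewrite -mem_undup mem_nth.
  - rewrite /reduced sorted_map; apply: sub_sorted rw => l l' /=.
    apply: contra => /andP[/eqP xx bb]; apply/eqP.
    have ll : l.1 = l'.1.
      by apply/val_inj/eqP; rewrite -(nth_uniq 1 _ _ (undup_uniq L)) ?ltn_ord //; apply/eqP.
    by rewrite /linv ll [l']surjective_pairing /=; case: l.2 l'.2 bb => [] [].
  - by rewrite -size_eq0 size_map size_eq0.
have words (s : seq G) : {subset s <= hs ++ ks} -> exists ws, [seq wval x w | w <- ws] = s.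
  elim: s => [|g s IH] sub; first by exists [::].
  have [|ws wsE] := IH; first by move=> h hs'; apply: sub; rewrite inE hs' orbT.
  have [w Lw' wg] := Lw _ (sub _ (mem_head _ _)).
  have [|w' w'E] := @entry_word _ (undup L) w; first by move=> l lw; rewrite mem_undup Lw'.
  by exists (w' :: ws); rewrite /= wsE /wval w'E wg.
have [ws1 ws1E] : exists ws, [seq wval x w | w <- ws] = hs.
  by apply: words => g gh; rewrite mem_cat gh.
have [ws2 ws2E] : exists ws, [seq wval x w | w <- ws] = ks.
  by apply: words => g gh; rewrite mem_cat gh orbT.
have [X sX gX] := hanna_neumann_words fx ws1 ws2.
exists X; last by rewrite gX ws1E ws2E gH gK.
apply: leq_trans sX _; rewrite ltnS; apply: leq_mul.
  by rewrite -(size_map (wval x)) ws1E; lia.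
by rewrite -(size_map (wval x)) ws2E; lia.
Qed.

End HannaNeumann.

(** * Subgroups of finite index *)

Section FiniteIndex.
Local Open Scope group_scope.
Local Open Scope classical_set_scope.
Context {G : groupType}.
Implicit Types (H F L : set G).

Lemma left_coset_eq F g h : subgroup F ->
  left_coset F g = left_coset F h <-> F (g^-1 * h).
Proof.
move=> sF; split=> [e|Fgh].
  have : left_coset F h h by exists 1; [apply: subgroup1 | rewrite mulg1].
  by rewrite -e => -[y Fy <-]; rewrite mulKg.
apply/seteqP; split=> _ [y Fy <-].
  exists (h^-1 * g * y); last by rewrite !mulgA mulgV mul1g.
  by apply: subgroupM => //; rewrite -[h^-1 * g]invgK invgM invgK; apply: subgroupV.
exists (g^-1 * h * y); last by rewrite !mulgA mulgV mul1g.
exact: subgroupM.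
Qed.

Lemma coset_index F m : subgroup F -> has_index F m ->
  exists idx : G -> 'I_m, forall g h, idx g = idx h <-> F (g^-1 * h).
Proof.
move=> sF /card_set_bijP[f [f_fun f_inj _]].
have flt g : (f (left_coset F g) < m)%N by exact: (f_fun _ (ex_intro2 _ _ g I erefl)).
exists (fun g => Ordinal (flt g)) => g h; rewrite -left_coset_eq //.
split=> [/(congr1 val) /= e|e]; last by apply: val_inj; rewrite /= e.
by apply: f_inj e; apply/mem_set; [exists g | exists h].
Qed.

(** Schreier's bound: the intersection is the loop group of the coset graph of
    [H], which has at most [m] vertices and, for each of them, one edge for each
    generator. *)
Lemma schreier_bound F H m n : subgroup F -> has_index F m -> subgroup H ->
  generated_by H n.+1 -> generated_by (H `&` F) (m * n).+1.
Proof.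
move=> sF /(coset_index sF)[idx idxP] sH [hs shs gH].
pose x := @entry G hs.
have HE g : H g <-> exists w, wval x w = g by rewrite -gH generated_entry.
have Hx i : H (x i) by apply/HE; exists [:: (i, false)]; rewrite wval1.
(* the right coset of an element is the inverse of the left coset of its inverse *)
pose c g := idx g^-1.
have cP g h : c g = c h <-> F (g * h^-1) by rewrite /c idxP invgK.
pose VS := [set v | `[< exists2 g, H g & c g = v >]]%SET.
pose E := [set e : 'I_m * 'I_(size hs) * 'I_m |
  `[< exists g, [/\ H g, c g = e.1.1 & c (g * x e.1.2) = e.2] >]]%SET.
have VSP g : H g -> c g \in VS by move=> Hg; rewrite inE; apply/asboolP; exists g.
have egP u l v : eg u l v \in E <-> exists g, [/\ H g, c g = u & c (g * lval x l) = v].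
  case: l => s []; rewrite inE; split=> [/asboolP|] [g /= [Hg]]; rewrite /lval /letter_val /=.
  - by move=> gv gu; exists (g * x s); rewrite gu mulgK gv; split=> //; apply: subgroupM.
  - move=> gu gv; apply/asboolP; exists (g * (x s)^-1); rewrite mulgVK gv gu; split=> //.
    by apply: subgroupM => //; apply: subgroupV.
  - by move=> gu gv; exists g.
  - by move=> gu gv; apply/asboolP; exists g.
have walkP u w v : walk E u w v -> forall g, H g -> c g = u -> c (g * wval x w) = v.
  elim: w u => [|l w IH] u /=; first by move=> -> g Hg; rewrite wval_nil mulg1.
  move=> [r /egP[g [Hg gu gr]] wr] h Hh hu; rewrite wval_cons mulgA.
  have Hl : H (lval x l) by apply/HE; exists [:: l]; rewrite wval1.
  apply: IH wr _ (subgroupM sH Hh Hl) _; rewrite -gr; apply/cP.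
  by rewrite invgM mulgA mulgK; apply/cP; rewrite hu.
have walkI w g : H g -> walk E (c g) w (c (g * wval x w)).
  elim: w g => [|l w IH] g Hg /=; first by rewrite wval_nil mulg1.
  have Hl : H (lval x l) by apply/HE; exists [:: l]; rewrite wval1.
  exists (c (g * lval x l)); first by apply/egP; exists g.
  by rewrite wval_cons mulgA; apply: IH; apply: subgroupM.
have H1 : H 1 := subgroup1 sH.
have conn : connected_on VS E (c 1).
  split; first exact: VSP.
    by move=> u l v /egP[g [Hg <- _]]; apply: VSP.
  move=> v; rewrite inE => /asboolP[_ /HE[w <-] <-]; exists w.
  by have := walkI w 1 H1; rewrite mul1g.
have [X [sX gX]] := loops_generated x conn.
exists X.
  have cE : (#|E| <= #|VS| * n.+1)%N.
    apply: leq_trans (_ : #|finset.setX VS [set: 'I_(size hs)]%SET| <= _)%N; last first.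
      by rewrite cardsX cardsT card_ord leq_mul2l shs orbT.
    have inj : {in E &, injective (fun e : 'I_m * 'I_(size hs) * 'I_m => e.1)}.
      move=> [[u s] v] [[u' s'] v']; rewrite -[(u, s, v)]/(eg u (s, false) v).
      rewrite -[(u', s', v')]/(eg u' (s', false) v') => /egP[g [_ gu gv]] /egP[h [_ hu hv]] /= [uu ss].
      rewrite -uu -ss in hu hv *; suff -> : v = v' by [].
      by rewrite -gv -hv; apply/cP; rewrite invgM mulgA mulgK; apply/cP; rewrite gu hu.
    rewrite -(card_in_imset inj); apply: subset_leq_card.
    apply/fintype.subsetP => _ /imsetP[e eE ->]; rewrite !inE andbT.
    by move: eE; rewrite inE => /asboolP[g [Hg gu _]]; apply/asboolP; exists g.
  have leVS : (#|VS| <= m)%N by rewrite -[leqRHS]card_ord max_card.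
  rewrite -(leq_add2r #|VS|) sX addSn ltnS (leq_trans cE) //.
  by rewrite mulnS addnC leq_add2r leq_mul2r leVS orbT.
rewrite gX; apply/seteqP; split=> [g [w wc <-]|g [/HE[w <-] Fw]].
  split; first by apply/HE; exists w.
  have := walkP _ _ _ wc _ H1 erefl; rewrite mul1g => /cP.
  by rewrite invg1 mulg1.
exists w => //; have := walkI w 1 H1; rewrite mul1g.
by rewrite (_ : c (wval x w) = c 1) //; apply/cP; rewrite invg1 mulg1.
Qed.

(** One generator is added for each coset of [F], other than [F] itself, which
    meets [L]. *)
Lemma index_bound F L m r : subgroup F -> has_index F m -> subgroup L ->
  generated_by (L `&` F) r -> generated_by L (r + m.-1).
Proof.
move=> sF /(coset_index sF)[idx idxP] sL [X sX gX].
have L1 := subgroup1 sL.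
have [rep repP] : exists rep : 'I_m -> G, forall g, L g ->
    L (rep (idx g)) /\ idx (rep (idx g)) = idx g.
  suff /choice[rep repP] : forall i, exists h, forall g, L g -> idx g = i -> L h /\ idx h = i.
    by exists rep => g Lg; apply: repP Lg erefl.
  move=> i; have [[g Lg gi]|no] := pselect (exists2 g, L g & idx g = i).
    by exists g => h _ _.
  by exists 1 => g Lg gi; exfalso; apply: no; exists g.
pose VS := [set i | `[< exists2 g, L g & idx g = i >]]%SET.
pose X' := X ++ [seq rep i | i <- enum (VS :\ idx 1)].
exists X'.
  rewrite size_cat size_map -cardE; apply: leq_add => //.
  have v1 : idx 1 \in VS by rewrite inE; apply/asboolP; exists 1.
  have := cardsD1 (idx 1) VS; rewrite v1.
  have : (#|VS| <= m)%N by rewrite -[leqRHS]card_ord max_card.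
  by lia.
have sX' := generated_subgroup [set` X'].
apply/seteqP; split.
  apply: generated_min => // g /=; rewrite mem_cat => /orP[gX'|].
    by have [] : (L `&` F) g by rewrite -gX; apply: sub_generated.
  move=> /mapP[i + ->]; rewrite mem_enum !inE => /andP[_ /asboolP[h Lh <-]].
  by case: (repP h Lh).
move=> g Lg; have sub h : L h -> F h -> generated [set` X'] h.
  move=> Lh Fh; have : generated [set` X] h by rewrite gX.
  apply: generated_min => // k kX; apply: sub_generated.
  by rewrite /= mem_cat kX.
have [e|ne] := eqVneq (idx g) (idx 1).
  apply: sub => //; move: e => /idxP; rewrite mulg1 => /(subgroupV sF).
  by rewrite invgK.
have [Lr ri] := repP g Lg.
rewrite -[g](mulVKg (rep (idx g))); apply: (subgroupM sX').
  apply: sub_generated; rewrite /= mem_cat; apply/orP; right.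
  apply: map_f; rewrite mem_enum !inE ne; apply/asboolP; by exists g.
apply: sub; first by apply: subgroupM => //; apply: subgroupV.
by apply/idxP.
Qed.

(** The ranks of [H1] and [H2] grow to at most [m * n + 1] on passing to [F],
    where the Hanna Neumann inequality applies; going back from
    [H1 `&` H2 `&` F] to [H1 `&` H2] costs one generator for each further
    coset. *)
Lemma intersection_bound F H1 H2 m n1 n2 :
  free_subgroup F -> has_index F m -> subgroup H1 -> subgroup H2 ->
  generated_by H1 n1.+1 -> generated_by H2 n2.+1 ->
  generated_by (H1 `&` H2) (m ^ 2 * n1 * n2 + m)%N.
Proof.
move=> frF iF s1 s2 g1 g2; have [sF _] := frF.
have m0 : (0 < m)%N by have [idx _] := coset_index sF iF; case: (idx 1) => k; apply: leq_ltn_trans.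
have gF := hanna_neumann frF (@subIsetr _ H1 F) (@subIsetr _ H2 F)
  (schreier_bound sF iF s1 g1) (schreier_bound sF iF s2 g2).
have := index_bound sF iF (subgroupI s1 s2) (r := (m * n1 * (m * n2)).+1).
rewrite setIIl => /(_ gF).
by congr generated_by; rewrite addSn -addnS prednK // expnS expn1; lia.
Qed.

(** The rank is an infimum of natural numbers, so it is attained once it is
    below [n + 1]. *)
Lemma rk_leP H n : (rk H <= (n%:R%R)%:E)%E <-> generated_by H n.
Proof.
split=> [le|[X sX gX]].
  have : (rk H < (n.+1%:R%R)%:E)%E.
    by apply: le_lt_trans le _; rewrite lte_fin ltr_nat.
  move=> /ereal_inf_lt[_ [X gX <-]]; rewrite lte_fin ltr_nat ltnS => sX.
  by exists X.
apply: ge_ereal_inf; exists (#|` [fset g in X]%fset|%:R)%R%:E.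
  exists [fset g in X]%fset => //=; rewrite -gX; congr generated.
  by apply/seteqP; split=> g /=; rewrite inE.
by rewrite lee_fin ler_nat (leq_trans _ sX) // card_fseq size_undup.
Qed.

End FiniteIndex.

(** * Virtually free groups *)

Theorem corollary3p3 (G : groupType) (F : set G) (m : nat)
    (F_free : free_subgroup F) (F_index : has_index F m) :
  strongly_Howson G /\
  forall n1 n2 : nat, (1 <= n1)%N -> (1 <= n2)%N ->
    (xi G n1 n2 <=
      ((m%:R ^+ 2 * (n1%:R - 1) * (n2%:R - 1) + m%:R)%R : RR)%:E)%E.
Proof.
have bound n1 n2 : (xi G n1 n2 <= ((m ^ 2 * n1.-1 * n2.-1 + m)%:R%R)%:E)%E.
  apply: ge_ereal_sup => _ [H1 [H2 [s1 s2 r1 r2 ->]]]; apply/rk_leP.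
  (* the predecessor truncates at 0: a bound of 0 generators is relaxed to 1 *)
  have wider (H : set G) n : (rk H <= (n%:R%R)%:E)%E -> generated_by H n.-1.+1.
    by move=> /rk_leP[X sX gX]; exists X => //; apply: leq_trans (leqSpred n).
  exact: intersection_bound F_free F_index s1 s2 (wider _ _ r1) (wider _ _ r2).
split=> [n1 n2|n1 n2 n1_gt0 n2_gt0].
  by apply: le_lt_trans (bound n1 n2) _; rewrite ltry.
apply: le_trans (bound n1 n2) _; rewrite lee_fin.
by rewrite natrD 2!natrM natrX -!subn1 !natrB.
Qed.
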